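(* Let $L=\mathbb{Z}\alpha$ be a rank one negative definite even lattice, $\langle\alpha,\alpha\rangle=-2k$ with $k\in\mathbb{Z}_{>0}$. Then $V_L^+=C_2(V_L^+)$; in particular $V_L^+$ satisfies the $C_2$-cofiniteness condition and $V_L^+/C_2(V_L^+)=0$.
   Context: Let $L$ be an even lattice with non-degenerate form $\langle\cdot,\cdot\rangle$, $\mathfrak{h}=\mathbb{C}\otimes_{\mathbb{Z}}L$, $M(1)$ the Heisenberg vertex algebra on $\mathfrak{h}$, and $V_L=M(1)\otimes\mathbb{C}[L]$ the lattice vertex algebra (a $\mathbb{Z}$-graded vertex algebra with conformal vector $\omega=\frac12\sum_ih_i(-1)^2\mathbf{1}$, $\{h_i\}$ an orthonormal basis of $\mathfrak{h}$). Let $\theta$ be the automorphism of $V_L$ given by $\theta(\beta_1(-n_1)\cdots\beta_r(-n_r)e^\beta)=(-1)^r\beta_1(-n_1)\cdots\beta_r(-n_r)e^{-\beta}$, and $V_L^+$ its fixed-point vertex subalgebra. $C_2(V)=\mathrm{Span}_{\mathbb{C}}\{u_{-2}v\mid u,v\in V\}$ with $Y(u,z)=\sum_nu_nz^{-n-1}$; $V$ satisfies the $C_2$-cofiniteness condition if $\dim V/C_2(V)<\infty$. *)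

(* Defs.v *)
From HB Require Import structures.
From mathcomp Require Import all_boot all_order all_algebra.
Set Implicit Arguments. Unset Strict Implicit. Unset Printing Implicit Defensive.
Import Order.TTheory GRing.Theory Num.Theory.
Local Open Scope ring_scope.

Section LatticeVA.
Variable F : fieldType.
Variable k : nat.

(* Basis vector (s, m) of V_L = M(1) (x) C[L]:
     alpha(-(s_1+1)) ... alpha(-(s_r+1)) e^{m alpha}.
   The entry j of s codes the creation operator alpha(-(j+1)); the order of s
   is irrelevant (M(1) is a polynomial algebra), see [coeff]. *)
Definition basis := (seq nat * int)%type.

Definition vec := seq (F * basis).

Definition coeff (v : vec) (b : basis) : F :=
  \sum_(x <- v | perm_eq x.2.1 b.1 && (x.2.2 == b.2)) x.1.

Definition veq (v w : vec) : Prop := forall b, coeff v b = coeff w b.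

Definition scalev (c : F) (v : vec) : vec := [seq (c * x.1, x.2) | x <- v].

Definition linext (f : basis -> vec) (v : vec) : vec :=
  flatten [seq scalev x.1 (f x.2) | x <- v].

(* The bilinear form on L = Z alpha:  <a alpha, b alpha> = -2k a b. *)
Definition form (a b : int) : int := - (2%:Z * k%:Z * a * b).

(* Weight (L(0)-eigenvalue of the M(1)-part) of a monomial. *)
Definition wt (s : seq nat) : nat := (sumn s + size s)%N.

(* Heisenberg operators alpha(n), n in Z, on basis vectors:
   alpha(-(p+1)) multiplies by alpha(-(p+1));
   alpha(0) acts on e^{m alpha} by <alpha, m alpha>;
   alpha(p+1) acts as (p+1)<alpha,alpha> d/d alpha(-(p+1)). *)
Definition alpha (n : int) (b : basis) : vec :=
  match n with
  | Posz 0 => [:: ((form 1 b.2)%:~R, b)]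
  | Posz p.+1 =>
      flatten [seq (if nth 0%N b.1 i == p
                    then [:: (((p.+1)%:Z * form 1 1)%:~R,
                              (take i b.1 ++ drop i.+1 b.1, b.2))]
                    else [::]) | i <- iota 0 (size b.1)]
  | Negz p => [:: (1, (p :: b.1, b.2))]
  end.

Definition alphav (n : int) (v : vec) : vec := linext (alpha n) v.

(* Coefficients of exp(sum_{m>=1} x_m z^m / m) applied to v:
   P_0 = id,  r P_r = sum_{m=1}^r x_m P_{r-m}.
   [expl x r v] = [:: P_r v; P_{r-1} v; ...; P_0 v]. *)
Fixpoint expl (x : nat -> vec -> vec) (r : nat) (v : vec) : seq vec :=
  match r with
  | 0%N => [:: v]
  | r'.+1 =>
      let l := expl x r' v in
      scalev (r'.+1%:R)^-1
        (flatten [seq x m.+1 (nth [::] l m) | m <- iota 0 r'.+1]) :: l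
  end.

Definition expc (x : nat -> vec -> vec) (r : nat) (v : vec) : vec :=
  head [::] (expl x r v).

(* For beta = a alpha:
   coefficient of z^r in E^-(-beta,z) = exp(sum_{m>0} beta(-m) z^m / m)   *)
Definition Em (a : int) (r : nat) (v : vec) : vec :=
  expc (fun m w => scalev a%:~R (alphav (Negz m.-1) w)) r v.
(* coefficient of z^{-q} in E^+(-beta,z) = exp(-sum_{m>0} beta(m) z^{-m} / m) *)
Definition Ep (a : int) (q : nat) (v : vec) : vec :=
  expc (fun m w => scalev (- a%:~R) (alphav (Posz m) w)) q v.

(* Mode n of e^{a alpha}, i.e. coefficient of z^{-n-1} in
   Y(e^beta, z) = E^-(-beta,z) E^+(-beta,z) e_beta z^beta  (beta = a alpha),
   with the trivial 2-cocycle (legitimate since <L,L> is contained in 2Z),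
   applied to the basis vector t e^{b alpha}.  The E^+ part acting on t
   vanishes beyond the weight of t. *)
Definition mode_e (a n : int) (v : basis) : vec :=
  flatten [seq (let r := (q%:Z - form a v.2 - n - 1)%R in
                if (0 <= r)%R
                then Em a (absz r) (Ep a q [:: (1, (v.1, a + v.2))])
                else [::]) | q <- iota 0 (wt v.1).+1].

(* Mode n of the basis vector (s, a) applied to the basis vector v, defined
   by the normal ordered product
     Y(alpha(-J) w, z) = : (d^{(J-1)} alpha(z)) Y(w, z) :,
   i.e. (alpha(-J) w)_n =
      sum_{i>=0} C(J-1+i, i) [ alpha(-J-i) w_{n+i}
                               + (-1)^{J+1} w_{n-J-i} alpha(i) ].
   Both sums are finite on v; the truncations are safe bounds:
   w_p v = 0 for p >= wt(w) + wt(v) + |<beta,gamma>|, and alpha(i) v = 0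
   for i > wt(v). *)
Fixpoint mode (s : seq nat) (a : int) (n : int) (v : basis) {struct s} : vec :=
  match s with
  | [::] => mode_e a n v
  | j :: s' =>
      let B : int := (wt s' + wt v.1 + absz (form a v.2))%N in
      flatten [seq scalev ('C(j + i, i))%:R
                      (alphav (Negz (j + i)) (mode s' a (n + i%:Z) v))
              | i <- iota 0 (absz (B - n)).+1]
      ++
      flatten [seq scalev ((-1) ^+ (j.+2) * ('C(j + i, i))%:R)
                      (linext (mode s' a (n - (j.+1)%:Z - i%:Z))
                              (alpha (Posz i) v))
              | i <- iota 0 (wt v.1).+1]
  end.

Definition modev (u : vec) (n : int) (v : vec) : vec :=
  flatten [seq scalev (x.1 * y.1) (mode x.2.1 x.2.2 n y.2) | x <- u, y <- v].

Definition thetav (v : vec) : vec :=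
  [seq ((-1) ^+ size x.2.1 * x.1, (x.2.1, - x.2.2)) | x <- v].

Definition in_Vplus (v : vec) : Prop := veq (thetav v) v.

Definition in_C2_Vplus (w : vec) : Prop :=
  exists l : seq (vec * vec),
    (forall p, p \in l -> in_Vplus p.1 /\ in_Vplus p.2) /\
    veq w (flatten [seq modev p.1 (-2) p.2 | p <- l]).

End LatticeVA.

(* Main.v *)
Require Import Defs.
From HB Require Import structures.
From mathcomp Require Import all_boot all_order all_algebra.
From Stdlib Require ClassicalEpsilon FunctionalExtensionality.
From mathcomp Require Import finmap multiset monalg ring zify.
Set Implicit Arguments. Unset Strict Implicit. Unset Printing Implicit Defensive.
Import Order.TTheory GRing.Theory Num.Theory.
Local Open Scope ring_scope.
Local Notation form := Defs.form.

(* Write V[b] for the charge-b part M(1) (x) e^(b alpha), x_c = alpha(-c), and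
   call v good if v + theta v lies in C_2(V_L^+); it suffices that every v is
   good. Modes u_(-n) y with n >= 2 and u in M(1)^+ quadratic, and L(-1) y, are
   good; modulo their span D, the part V[b] with b <> 0 is spanned by the
   vectors omega^j e^b, where omega is the mode (x_1 x_1)_(-1). A second
   quadratic operator U, of weight 4, preserves D and commutes with omega
   modulo D, so some combination T_b of U and omega^2 maps V[b] into D.
   Finally e^m_n v + e^(-m)_n v is good for n <= -2; with v in V[m + b] and
   m, m + b > 0 this carries goodness between V[2m + b] and V[b], where the
   modes e^(-m)_n v exhaust V[b] because the form is negative definite. As
   omega and U are compatible with these sums, T_(2m+b) maps V[b] to good
   vectors; two values of m give independent combinations, so omega^2 y is
   always good. Hence everything of weight >= 4 in V[b], b <> 0, is good, and
   one more transfer, from V[2m + b] with m large, makes all of V[b] good. *)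

(** * Finitely supported sums over the integers *)

(** The reduction modulo D divides by b, so charge 0 is out of its reach and enters only as a target
    of the last transfer. For b <> 0 the quotient of V[b] by D is at most a line in each even weight
    and zero in each odd one. Hence U e^b and omega^2 e^b, both of weight 4, are proportional modulo
    D, and T_b records this proportion. The ratio depends on b only through Y = -2 <b alpha, b
    alpha>, so another charge gives an independent relation. Negativity of the form is needed again
    here: the factors linking omega x_N e^b to x_(N+2) e^b are nonzero because their terms add up
    with one sign, and so is the determinant of two operators T_b, once the difference of the two
    values of Y is split off. Omega and U respect pairs by parity: commuted with e^a_n, omega leaves
    coefficients even in a; U leaves in addition an odd multiple of modes of vectors x_j e^a, and
    x_j (e^m - e^(-m)) is fixed by theta. *)

Section ZSum.
Variable V : zmodType.
Implicit Types f g : int -> V.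

Definition zbound f (N : nat) := forall c : int, (N <= absz c)%N -> f c = 0.
Definition zfin f := exists N, zbound f N.
(** The range is -(N-1), ..., N: pairing i+1 with -i meets each integer once, and under [zbound f N]
    the extra index N contributes 0. *)
Definition zpart f (N : nat) := \sum_(i < N) (f i.+1%:Z + f (- i%:Z)).
(* The sum of [f] over the integers; a junk value unless [zfin f]. *)
Definition zs f :=
  zpart f (ClassicalEpsilon.epsilon (inhabits 0%N) (zbound f)).

Lemma zboundW f N M : (N <= M)%N -> zbound f N -> zbound f M.
Proof. by move=> le_NM fN c /(leq_trans le_NM)/fN. Qed.

Lemma zpart_stable f N M : zbound f N -> (N <= M)%N -> zpart f M = zpart f N.
Proof.
move=> fN le_NM; rewrite /zpart -(subnKC le_NM) big_split_ord /=.
by rewrite [X in _ + X]big1 ?addr0 // => i _; rewrite !fN ?addr0 //; lia.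
Qed.

Lemma zs_eq f N : zbound f N -> zs f = zpart f N.
Proof.
move=> fN; rewrite /zs; set M := ClassicalEpsilon.epsilon _ _.
have fM : zbound f M.
  by apply: ClassicalEpsilon.epsilon_spec; exists N.
rewrite -(zpart_stable fM (leq_maxl M N)).
by rewrite -(zpart_stable fN (leq_maxr M N)).
Qed.

Lemma eq_zs f g : f =1 g -> zs f = zs g.
Proof. by move=> fg; congr zs; apply: FunctionalExtensionality.functional_extensionality. Qed.

Lemma zfinD f g : zfin f -> zfin g -> zfin (fun c => f c + g c).
Proof.
move=> [N fN] [M gM]; exists (maxn N M) => c; rewrite geq_max => /andP[h1 h2].
by rewrite fN // gM // addr0.
Qed.

Lemma zsD f g : zfin f -> zfin g -> zs (fun c => f c + g c) = zs f + zs g.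
Proof.
move=> [N fN] [M gM].
have fP := zboundW (leq_maxl N M) fN; have gP := zboundW (leq_maxr N M) gM.
rewrite (zs_eq fP) (zs_eq gP) (@zs_eq _ (maxn N M)); last first.
  by move=> c hc; rewrite fP // gP // addr0.
by rewrite -big_split; apply: eq_bigr => i _; rewrite addrACA.
Qed.

Lemma zs0 : zs (fun _ => 0) = 0.
Proof. by rewrite (@zs_eq _ 0) // /zpart big_ord0. Qed.

Lemma zfin_shift f d : zfin f -> zfin (fun c => f (c + d)).
Proof.
by move=> [N fN]; exists (N + absz d)%N => c hc; apply: fN; lia.
Qed.

Lemma zs_shift1 f : zfin f -> zs (fun c => f (c + 1)) = zs f.
Proof.
move=> [N fN].
have fN1 : zbound (fun c => f (c + 1)) N.+1 by move=> c hc; apply: fN; lia.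
rewrite (zs_eq fN1) (zs_eq (zboundW (leqnSn N) fN)).
rewrite /zpart big_split [RHS]big_split /=.
rewrite big_ord_recr [X in _ + X]big_ord_recl /= [X in _ = X + _]big_ord_recl.
rewrite [X in _ = _ + X]big_ord_recr /=.
rewrite (fN (N.+1%:Z + 1)) ?addr0; last by lia.
rewrite (fN (- N%:Z)) ?addr0; last by lia.
rewrite addrCA -addrA.
congr (_ + _).
congr (_ + _); apply: eq_bigr => i _; congr f; rewrite /bump /=; lia.
Qed.

Lemma zs_shift f d : zfin f -> zs (fun c => f (c + d)) = zs f.
Proof.
have pos g (n : nat) : zfin g -> zs (fun c => g (c + n%:Z)) = zs g.
  move=> gf; elim: n => [|n IH]; first by apply: eq_zs => c; rewrite addr0.
  rewrite -IH -[RHS]zs_shift1; last exact: zfin_shift.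
  by apply: eq_zs => c; congr g; lia.
move=> ff; case: (lerP 0 d) => hd.
  by rewrite -(pos _ (absz d) ff); apply: eq_zs => c; congr f; lia.
rewrite -[LHS](pos _ (absz d)); last exact: zfin_shift.
by apply: eq_zs => c; congr f; lia.
Qed.

Lemma zs_opp f : zfin f -> zs (fun c => f (- c)) = zs f.
Proof.
move=> [N fN].
have gN : zbound (fun c => f (- c)) N.+1 by move=> c hc; apply: fN; lia.
rewrite (zs_eq gN) (zs_eq (zboundW (leqnSn N) fN)).
rewrite /zpart big_split [RHS]big_split /= addrC.
rewrite big_ord_recl [X in _ = X + _]big_ord_recr /=.
rewrite [X in _ + X = _]big_ord_recr [X in _ = _ + X]big_ord_recl /=.
rewrite (fN (- N.+1%:Z)) ?addr0; last by lia.
rewrite (fN (N.+1%:Z)) ?addr0; last by lia.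
by rewrite -addrA [RHS]addrCA; congr (_ + _).
Qed.

Lemma zs1 f d : (forall c, c != d -> f c = 0) -> zs f = f d.
Proof.
move=> fd.
have ff : zfin f by exists (absz d).+1 => c hc; apply: fd; apply/eqP; lia.
rewrite -(zs_shift d ff) (@zs_eq _ 1); last first.
  by move=> c hc; apply: fd; apply/eqP; lia.
rewrite /zpart big_ord1 oppr0 add0r fd ?add0r //.
by apply/eqP; lia.
Qed.

Lemma zs_exchange (f : int -> int -> V) (N : nat) :
  (forall c d, (N <= absz c)%N -> f c d = 0) ->
  (forall c d, (N <= absz d)%N -> f c d = 0) ->
  zs (fun c => zs (f c)) = zs (fun d => zs (fun c => f c d)).
Proof.
move=> h1 h2.
have E1 c : zs (f c) = zpart (f c) N by apply: zs_eq => d; apply: h2.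
have E2 d : zs (fun c => f c d) = zpart (fun c => f c d) N.
  by apply: zs_eq => c; apply: h1.
rewrite (eq_zs E1) (eq_zs E2) !(@zs_eq _ N); last first.
- by move=> c hc; rewrite /zpart big1 // => i _; rewrite !h1 ?addr0.
- by move=> c hc; rewrite /zpart big1 // => i _; rewrite !h2 ?addr0.
rewrite /zpart !big_split /= -!big_split /=.
rewrite (eq_bigr (fun i : 'I_N => \sum_(j < N) (f i.+1%:Z j.+1%:Z + f i.+1%:Z (- j%:Z)
   + (f (- i%:Z) j.+1%:Z + f (- i%:Z) (- j%:Z))))); last first.
  by move=> i _; rewrite -big_split.
rewrite exchange_big /=; apply: eq_bigr => j _; rewrite -big_split /=.
by apply: eq_bigr => i _; rewrite addrACA.
Qed.

End ZSum.

Lemma zfin_lin (V W : zmodType) (h : {additive V -> W}) f :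
  zfin f -> zfin (fun c => h (f c)).
Proof. by move=> [N fN]; exists N => c hc; rewrite fN // raddf0. Qed.

Lemma zs_lin (V W : zmodType) (h : {additive V -> W}) f :
  zfin f -> zs (fun c => h (f c)) = h (zs f).
Proof.
move=> [N fN]; rewrite (zs_eq fN) (@zs_eq _ _ N); last first.
  by move=> c hc; rewrite fN // raddf0.
by rewrite raddf_sum; apply: eq_bigr => i _; rewrite raddfD.
Qed.

Lemma zfinZ (R : nzRingType) (V : lmodType R) (a : int -> R) (f : int -> V) :
  zfin f -> zfin (fun c => a c *: f c).
Proof. by move=> [N fN]; exists N => c hc; rewrite fN // scaler0. Qed.
Arguments zs_lin {V W} h {f} _.
Arguments zfin_lin {V W} h {f} _.

Section ZSumMore.
Variable V : zmodType.
Implicit Types f g : int -> V.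

Lemma zs_nat f N : (forall c, c < 0 -> f c = 0) ->
  (forall c, N%:Z <= c -> f c = 0) -> zs f = \sum_(i < N) f i%:Z.
Proof.
move=> f0 fN; rewrite (@zs_eq _ _ N.+1); last first.
  by move=> c hc; have [/f0 //|c0] := ltrP c 0; apply: fN; lia.
rewrite /zpart big_split /= big_ord_recr /= fN ?addr0; last by lia.
rewrite [X in _ + X]big_ord_recl /= [X in _ + (_ + X)]big1 ?addr0; last first.
  by move=> i _; apply: f0; rewrite /bump /=; lia.
rewrite oppr0; case: N fN => [|N] fN; first by rewrite !big_ord0 add0r fN.
rewrite big_ord_recr [RHS]big_ord_recl /= fN ?addr0; last by lia.
by rewrite addrC; congr (_ + _); apply: eq_bigr => i _; congr f.
Qed.

(** Shaped after the two truncated sums in [mode]: the weight C(c-1, j) vanishes for 0 < c <= j, so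
    the positive side starts at j+1 and the other one at 0. *)
Lemma zs_split f j N1 N2 : (forall c, 0 < c <= j -> f c = 0) ->
  (forall c, j + 1 + N1%:Z <= c -> 0 < c -> f c = 0) ->
  (forall c, c <= - N2%:Z -> c <= 0 -> f c = 0) -> 0 <= j ->
  zs f = \sum_(i < N1) f (j + 1 + i%:Z) + \sum_(i < N2) f (- i%:Z).
Proof.
move=> f0 fN1 fN2 j0.
pose g c := if 0 < c then f c else 0; pose h c := if c <= 0 then f c else 0.
have gz : zfin g.
  exists (absz j + N1 + 1)%N => c hc; rewrite /g; case: ifP => // c0.
  by apply: fN1; lia.
have hz : zfin h.
  exists N2 => c hc; rewrite /h; case: ifP => // c0; apply: fN2; lia.
have -> : zs f = zs (fun c => g c + h c).
  by apply: eq_zs => c; rewrite /g /h; case: ltrP; rewrite ?addr0 ?add0r.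
rewrite zsD //; congr (_ + _).
  rewrite -(zs_shift (j + 1) gz) (@zs_nat _ N1).
  - by apply: eq_bigr => i _; rewrite /g ifT; [congr f; lia | lia].
  - by move=> c c0; rewrite /g; case: ifP => // cj; apply: f0; lia.
  - by move=> c c0; rewrite /g; case: ifP => // cj; apply: fN1; lia.
rewrite -(zs_opp hz) (@zs_nat _ N2).
- by apply: eq_bigr => i _; rewrite /h ifT //; lia.
- by move=> c c0; rewrite /h; case: ifP => // cj; lia.
- by move=> c c0; rewrite /h; case: ifP => // cj; apply: fN2; lia.
Qed.

End ZSumMore.

(** * The space V_L and its Heisenberg action *)

(* [(M, b)] is the monomial with factors alpha(-(j+1)), j in M, times e^(b alpha). *)
Definition K : choiceType := ({mset nat}%mset * int)%type.

(* The free module on [K] is only accessible through this opaque interface: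
   letting unification unfold [malg] is prohibitively slow. *)
Record free_module (F : numFieldType) := FreeModule {
  fm_sort : lmodType F;
  fm_basis : K -> fm_sort;
  fm_coord : K -> fm_sort -> F;
  fm_lift : (K -> fm_sort) -> fm_sort -> fm_sort;
  fm_coord_lin : forall b, scalar (fm_coord b);
  fm_lift_lin : forall f, linear (fm_lift f);
  fm_coordU : forall b b', fm_coord b (fm_basis b') = (b' == b)%:R;
  fm_liftU : forall f b, fm_lift f (fm_basis b) = f b;
  fm_coord_inj : forall x y,
    (forall b, fm_coord b x = fm_coord b y) -> x = y;
  fm_ind : forall P : fm_sort -> Prop, P 0 ->
    (forall c b x, P x -> P (c *: fm_basis b + x)) -> forall x, P x
}.

Section MalgFreeModule.
Variable F : numFieldType.
Local Notation V := {malg F[K]}.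

Let liftm (f : K -> V) (x : V) : V := \sum_(b <- msupp x) x@_b *: f b.

Let liftmEw (f : K -> V) (x : V) (d : {fset K}) :
  (msupp x `<=` d)%fset -> liftm f x = \sum_(b <- d) x@_b *: f b.
Proof.
move=> xd; rewrite /liftm (big_fset_incl _ xd) // => b _ nb.
by rewrite mcoeff_outdom ?scale0r.
Qed.

Fact malg_free_module : free_module F.
Proof.
apply: (@FreeModule F V (fun b => << b >>) (fun b x => x@_b) liftm).
- by move=> b c x y; rewrite mcoeffD mcoeffZ.
- move=> f c x y; pose d := (msupp x `|` msupp y)%fset.
  have xd : (msupp x `<=` d)%fset by apply: fsubsetUl.
  have yd : (msupp y `<=` d)%fset by apply: fsubsetUr.
  rewrite (liftmEw f xd) (liftmEw f yd) (@liftmEw _ _ d); last first.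
    apply: fsubset_trans (msuppD_le _ _) _; rewrite fsubUset yd andbT.
    exact: fsubset_trans (msuppZ_le _ _) xd.
  rewrite scaler_sumr -big_split; apply: eq_bigr => b _ /=.
  by rewrite mcoeffD mcoeffZ scalerDl scalerA.
- by move=> b b'; rewrite mcoeffU.
- by move=> f b; rewrite /liftm msuppU oner_eq0 big_seq_fset1 mcoeffUU scale1r.
- by move=> x y xy; apply/malgP.
move=> P P0 PS x; rewrite [x]monalgE.
elim: (enum_fset (msupp x)) => [|b s IH]; first by rewrite big_nil.
rewrite big_cons; have -> : << x@_b *g b >> = x@_b *: << b >> :> V.
  by apply/malgP => b'; rewrite mcoeffZ !mcoeffU mulr_natr.
exact: PS.
Qed.

End MalgFreeModule.

Section LatticeVertexAlgebra.
Variables (F : numFieldType) (k : nat).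

Definition V : lmodType F := fm_sort (malg_free_module F).
Definition bas : K -> V := @fm_basis F _.
Definition vcoord : K -> V -> F := @fm_coord F _.
Definition lift : (K -> V) -> V -> V := @fm_lift F _.

HB.instance Definition _ (f : K -> V) :=
  GRing.isLinear.Build F V V _ (lift f) (@fm_lift_lin F _ f).
HB.instance Definition _ (b : K) :=
  GRing.isLinear.Build F V F _ (@vcoord b) (@fm_coord_lin F _ b).

Lemma liftU (f : K -> V) b : lift f (bas b) = f b.
Proof. exact: fm_liftU. Qed.

Lemma vcoordU b b' : vcoord b (bas b') = (b' == b)%:R.
Proof. exact: fm_coordU. Qed.

Lemma vcoord_inj (x y : V) : (forall b, vcoord b x = vcoord b y) -> x = y.
Proof. exact: fm_coord_inj. Qed.

Lemma vcoordD c x y : vcoord c (x + y) = vcoord c x + vcoord c y :> F.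
Proof. exact: raddfD. Qed.
Lemma vcoordN c x : vcoord c (- x) = - vcoord c x :> F.
Proof. exact: raddfN. Qed.
Lemma vcoordZ c a x : vcoord c (a *: x) = a * vcoord c x :> F.
Proof. exact: linearZ. Qed.

Ltac lmod := apply: vcoord_inj => ?; rewrite !(vcoordD, vcoordN, vcoordZ).

Lemma VL_ind (P : V -> Prop) :
  P 0 -> (forall c b x, P x -> P (c *: bas b + x)) -> forall x, P x.
Proof. exact: fm_ind. Qed.

Definition kap : F := (form k 1 1)%:~R.

Lemma kapE : kap = - (2 * k)%:R.
Proof. by rewrite /kap /Defs.form !mulr1 rmorphN /= -PoszM. Qed.

Lemma formE a b : (form k a b)%:~R = kap * a%:~R * b%:~R :> F.
Proof. by rewrite /kap /Defs.form !mulr1 !rmorphN !rmorphM /= !mulNr. Qed.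

Definition mseq (M : {mset nat}%mset) : seq nat := M.

Lemma mseqK M : seq_mset (mseq M) = M.
Proof. exact: seq_mset_id. Qed.

Definition wtm (M : {mset nat}%mset) : nat := wt M.

Lemma wt_perm s t : perm_eq s t -> wt s = wt t.
Proof. by move=> st; rewrite /wt (perm_size st) (perm_sumn st). Qed.

Lemma wtm_seq (s : seq nat) : wtm (seq_mset s) = wt s.
Proof. exact/wt_perm/perm_eq_seq_mset. Qed.

Lemma seq_mset_cons (p : nat) (s : seq nat) : seq_mset (p :: s) = (p +` seq_mset s)%mset.
Proof. by apply/msetP => q; rewrite mset1DE !mset_seqE /= eq_sym. Qed.

Lemma wtm_cons (p : nat) (M : {mset nat}%mset) : wtm (p +` M)%mset = (p.+1 + wtm M)%N.
Proof.
rewrite -{1}[M]seq_mset_id -seq_mset_cons wtm_seq /wtm /wt /=; lia.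
Qed.

Definition mon (s : seq nat) (b : int) : V := bas (seq_mset s, b).

Definition Ab (p : int) (b : K) : V :=
  match p with
  | Negz p => bas ((p +` b.1)%mset, b.2)
  | Posz 0 => (kap * b.2%:~R) *: bas b
  | Posz p.+1 => (p.+1%:R * kap * (b.1 p)%:R) *: bas ((b.1 `\ p)%mset, b.2)
  end.

Definition A (p : int) : V -> V := lift (Ab p).
HB.instance Definition _ p := GRing.Linear.on (A p).

Lemma AD p x y : A p (x + y) = A p x + A p y. Proof. exact: linearD. Qed.
Lemma AZ p c x : A p (c *: x) = c *: A p x. Proof. exact: linearZ. Qed.

Lemma AU p b : A p (bas b) = Ab p b.
Proof. exact: liftU. Qed.

Lemma A_mon j s b : A (Negz j) (mon s b) = mon (j :: s) b.
Proof. by rewrite /mon AU seq_mset_cons. Qed.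

Lemma A0_mon s b : A 0 (mon s b) = (kap * b%:~R) *: mon s b.
Proof. by rewrite /mon AU. Qed.

Lemma Apos_vac p b : (0 < p) -> A p (mon [::] b) = 0.
Proof.
case: p => [[//|p] _|//]; rewrite /mon AU /Ab /= mset_seqE /=.
by rewrite mulr0 scale0r.
Qed.

Lemma heisenberg p q v :
  A p (A q v) = A q (A p v) + (if p + q == 0 then p%:~R * kap else 0) *: v.
Proof.
(* The central term is antisymmetric in p and q, so the ordered case suffices. *)
wlog: p q / p <= q => [W|].
  case: (lerP p q) => [/W //|/ltW/W H]; rewrite {}H -addrA -scalerDl.
  rewrite [q + p]addrC; case: eqP => [e|_]; last by rewrite addr0 scale0r addr0.
  have -> : q = - p by lia.
  by rewrite rmorphN mulNr addNr scale0r addr0.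
move=> le_pq; elim/VL_ind: v => [|c b v IH].
  by rewrite !raddf0 addr0.
rewrite !linearP /=.
rewrite IH; set d := (if _ then _ else _).
suff -> : A p (A q (bas b)) = A q (A p (bas b)) + d *: bas b.
  by rewrite scalerDr -!addrA; congr (_ + _); rewrite addrCA.
rewrite {}/d {IH v c}.
have Abc p' c b' : A p' (c *: bas b') = c *: Ab p' b' by rewrite linearZ /= AU.
case: b p q le_pq => [M b] [[|p]|p] [[|q]|q] //= le_pq;
  rewrite ?scale0r ?addr0 !AU /Ab /= ?Abc ?AU /= ?scalerA.
- by rewrite mul0r scale0r addr0.
- by congr (_ *: _); rewrite mulrC.
- case: (eqVneq p q) => [-> //|ne].
  have h1 : ((M `\ q)%mset p = M p)%N by rewrite msetB1E (negbTE ne) subn0.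
  have h2 : ((M `\ p)%mset q = M q)%N.
    by rewrite msetB1E eq_sym (negbTE ne) subn0.
  rewrite h1 h2 mulrC; congr (_ *: bas (_, _)).
  by apply/msetP => r; rewrite !msetB1E subnAC.
- by [].
- have -> : (Negz p + Posz q.+1 == 0) = (p == q) by apply/eqP/eqP; lia.
  rewrite mset1DE; case: (eqVneq p q) => [<-|ne].
    (* If p does not occur in M, removing it leaves M unchanged, but the coefficient [M p] is then
       0. *)
    rewrite msetD1K; case: (posnP (M p)) => [->|Mp].
      by rewrite mulr0 scale0r -scalerDl NegzE rmorphN /= mulr1 mulNr subrr scale0r.
    rewrite msetB1K -?mset_gt0 // -scalerDl; congr (_ *: _).
    rewrite NegzE rmorphN /= natrD; ring.
  rewrite scale0r addr0 add0n.
  congr (_ *: bas (_, _)).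
  apply/msetP => r; rewrite !(mset1DE, msetB1E).
  by case: (eqVneq r p) => [->|_] //; rewrite (negbTE ne) !subn0.
- by congr (bas (_, _)); apply/msetP => r; rewrite !mset1DE addnCA.
Qed.

(** The weight is an integer so that operators may shift it freely; a negative weight forces the
    vector to be 0 ([homog_neg]), which is the source of the truncations below. *)
Definition homog (d b : int) (x : V) :=
  forall c : K, vcoord c x != 0 -> (wtm c.1)%:Z = d /\ c.2 = b.

Lemma homog0 d b : homog d b 0.
Proof. by move=> c; rewrite raddf0 eqxx. Qed.

Lemma homogD d b x y : homog d b x -> homog d b y -> homog d b (x + y).
Proof.
move=> hx hy c; rewrite raddfD /=.
have [->|/hx //] := eqVneq (vcoord c x) 0.
by rewrite add0r => /hy.
Qed.

Lemma homogZ d b a x : homog d b x -> homog d b (a *: x).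
Proof.
move=> hx c; rewrite linearZ /= mulf_eq0 negb_or => /andP[_]; exact: hx.
Qed.

Lemma homog_sum d b (I : Type) (r : seq I) (P : pred I) (f : I -> V) :
  (forall i, P i -> homog d b (f i)) -> homog d b (\sum_(i <- r | P i) f i).
Proof.
move=> hf; elim/big_ind: _ => //; [exact: homog0 | exact: homogD].
Qed.

Lemma homog_zs d b (f : int -> V) :
  (forall c, homog d b (f c)) -> homog d b (zs f).
Proof. by move=> hf; apply: homog_sum => i _; apply: homogD. Qed.

Lemma homog_bas M b : homog (wtm M)%:Z b (bas (M, b)).
Proof.
by move=> c; rewrite vcoordU; case: (eqVneq _ c) => [<-|]; rewrite //= eqxx.
Qed.

Lemma homog_neg d b x : d < 0 -> homog d b x -> x = 0.
Proof.
move=> d0 hx; apply: vcoord_inj => c; rewrite raddf0.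
by have [//|/hx [h _]] := eqVneq (vcoord c x) 0; lia.
Qed.

Definition proj (d b : int) : V -> V :=
  lift (fun c : K => if ((wtm c.1)%:Z == d) && (c.2 == b) then bas c else 0).
HB.instance Definition _ d b := GRing.Linear.on (proj d b).

Lemma projE d b x c :
  vcoord c (proj d b x) =
  if ((wtm c.1)%:Z == d) && (c.2 == b) then vcoord c x else 0.
Proof.
elim/VL_ind: x => [|a c' x IH]; first by rewrite !raddf0 if_same.
rewrite !linearP /= IH /proj liftU; case: (eqVneq c' c) => [->|ne].
  by case: ifP; rewrite ?raddf0 //= mulr0 addr0.
rewrite vcoordU (negbTE ne) mulr0 add0r.
by case: (ifP _) => _; rewrite ?vcoordU ?(negbTE ne) ?raddf0 mulr0 add0r.
Qed.

Lemma proj_id d b x : homog d b x -> proj d b x = x.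
Proof.
move=> hx; apply: vcoord_inj => c; rewrite projE; case: ifP => // h.
have [//|/hx [h1 h2]] := eqVneq (vcoord c x) 0.
by rewrite h1 h2 !eqxx in h.
Qed.

(** The induction [VL_ind] leaves the homogeneous part; applying [proj] to the vector built so far
    brings it back. *)
Lemma homog_ind d b (P : V -> Prop) : P 0 ->
  (forall a M x, (wtm M)%:Z = d -> homog d b x -> P x ->
     P (a *: bas (M, b) + x)) ->
  forall x, homog d b x -> P x.
Proof.
move=> P0 PS x hx; rewrite -(proj_id hx).
have hp y : homog d b (proj d b y).
  by move=> c; rewrite projE; case: ifP; rewrite ?eqxx // => /andP[/eqP-> /eqP->].
elim/VL_ind: {hx}x => [|a [M b'] x IH]; first by rewrite raddf0.
rewrite linearP /= {1}/proj liftU /=; case: ifP => [/andP[/eqP hd /eqP ->]|_].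
  exact: PS.
by rewrite scaler0 add0r.
Qed.

Lemma homog_lin d b d' b' (f : {linear V -> V}) :
  (forall M, (wtm M)%:Z = d -> homog d' b' (f (bas (M, b)))) ->
  forall x, homog d b x -> homog d' b' (f x).
Proof.
move=> hf; apply: homog_ind => [|a M x hM hx IH].
  by rewrite raddf0; apply: homog0.
by rewrite linearP /=; apply: homogD => //; apply/homogZ/hf.
Qed.

Lemma homog_A p d b x : homog d b x -> homog (d - p) b (A p x).
Proof.
apply: homog_lin => M hM; rewrite /= AU; case: p => [[|p]|p] /=.
- by rewrite subr0 -hM; apply/homogZ/homog_bas.
- case: (posnP (M p)) => [->|Mp].
    by rewrite mulr0 scale0r; apply: homog0.
  apply: homogZ; have -> : d - p.+1%:Z = (wtm (M `\ p)%mset)%:Z; last exact: homog_bas.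
  by rewrite -hM -[in LHS](@msetB1K _ p M) ?wtm_cons -?mset_gt0 //; lia.
- have -> : d - Negz p = (wtm (p +` M)%mset)%:Z; last exact: homog_bas.
  by rewrite -hM wtm_cons; lia.
Qed.

Definition sh (a : int) : V -> V := lift (fun c : K => bas (c.1, a + c.2)).
HB.instance Definition _ a := GRing.Linear.on (sh a).

Lemma shU a M b : sh a (bas (M, b)) = bas (M, a + b).
Proof. exact: liftU. Qed.

Lemma homog_sh a d b x : homog d b x -> homog d (a + b) (sh a x).
Proof. by apply: homog_lin => M <-; rewrite /= shU; apply: homog_bas. Qed.

Lemma A_sh a p x : A p (sh a x) =
  sh a (A p x) + (if p == 0 then kap * a%:~R else 0) *: sh a x.
Proof.
elim/VL_ind: x => [|c [M b] x IH]; first by rewrite !raddf0 addr0.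
rewrite !linearP /= IH; set d := (if _ then _ else _).
suff -> : A p (sh a (bas (M, b))) = sh a (A p (bas (M, b))) + d *: sh a (bas (M, b)).
  by rewrite scalerDr -!addrA; congr (_ + _); rewrite addrCA.
rewrite /d shU !AU; case: p {d IH} => [[|p]|p] /=.
- by rewrite linearZ /= shU -scalerDl addrC -mulrDr -rmorphD.
- by rewrite linearZ /= shU scale0r addr0.
- by rewrite shU scale0r addr0.
Qed.

Hypothesis hk : (0 < k)%N.

Lemma kap0 : kap != 0.
Proof. by rewrite kapE oppr_eq0 pnatr_eq0; lia. Qed.

Arguments homog_A p {d b x} _ _ _.
Arguments homog_sh a {d b x} _ _ _.
Arguments homog_bas M b : clear implicits.

(** * Exponential series and the modes of e^(a alpha) *)

Section Generic.
Variable x : nat -> V -> V.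

Fixpoint exps (r : nat) (v : V) : seq V :=
  match r with
  | 0%N => [:: v]
  | r'.+1 => let l := exps r' v in
    (r'.+1%:R)^-1 *: (\sum_(m < r'.+1) x m.+1 (nth 0 l m)) :: l
  end.

(** Extended by 0 to negative indices, so that recursions can be summed up to any common bound
    ([expo_rec]). *)
Definition expo (r : int) (v : V) : V :=
  if r is Posz r then head 0 (exps r v) else 0.

Lemma nth_exps r v m : (m <= r)%N -> nth 0 (exps r v) m = expo (r - m)%N v.
Proof.
elim: r m => [|r IH] [|m] //=; rewrite ?subn0 //.
by move=> mr; rewrite IH // subSS.
Qed.

Lemma expo_neg r v : r < 0 -> expo r v = 0. Proof. by case: r. Qed.

Hypothesis x_lin : forall m, linear (x m).
HB.instance Definition _ m := GRing.isLinear.Build F V V _ (x m) (x_lin m).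

Lemma expo_rec (r : int) v N : (r <= N%:Z) ->
  r%:~R *: expo r v = \sum_(m < N) x m.+1 (expo (r - m.+1%:Z) v).
Proof.
case: r => [[|r]|r] rN.
- rewrite scale0r big1 // => m _.
  by rewrite expo_neg ?raddf0 //; lia.
- have le_rN : (r.+1 <= N)%N by lia.
  rewrite -(subnKC le_rN) big_split_ord /= [X in _ + X]big1 ?addr0; last first.
    by move=> m _; rewrite expo_neg ?raddf0 //; lia.
  rewrite scalerA divff ?scale1r ?pnatr_eq0 //; apply: eq_bigr => m _.
  rewrite nth_exps; last by rewrite -ltnS.
  by congr (x _ (expo _ _)); have := ltn_ord m; lia.
- rewrite scaler0 big1 // => m _.
  by rewrite expo_neg ?raddf0 //; lia.
Qed.

Lemma expo_ind (P : int -> Prop) :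
  (forall r, r < 0 -> P r) -> P 0 ->
  (forall r, 0 < r -> (forall r', r' < r -> P r') -> P r) -> forall r, P r.
Proof.
move=> Pn P0 PS r; have [/Pn //|] := ltrP r 0.
have [n] := ubnP (absz r); elim: n r => // n IH r rn r0.
have [->//|rne] := eqVneq r 0; apply: PS; first by lia.
by move=> r' lt_r; have [/Pn //|r'0] := ltrP r' 0; apply: IH; lia.
Qed.

Lemma scaler_intI (r : int) (u v : V) : 0 < r -> r%:~R *: u = r%:~R *: v -> u = v.
Proof.
move=> r0 /(congr1 (fun w => (r%:~R)^-1 *: w)).
by rewrite !scalerA mulVf ?scale1r // intr_eq0 gt_eqF.
Qed.

Lemma expo_lin r : linear (expo r).
Proof.
elim/expo_ind: r => [r r0|//|r r0 IH] c u v.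
  by rewrite !expo_neg // scaler0 addr0.
have rN : (r <= (absz r)%:Z) by lia.
apply: (scaler_intI r0); rewrite scalerDr scalerA mulrC -scalerA.
rewrite !(expo_rec _ rN) scaler_sumr -big_split; apply: eq_bigr => m _.
by rewrite /= IH ?linearP //; lia.
Qed.

End Generic.

(* [E c t r] is the coefficient of z^r in exp (c sum_(m > 0) A_(t m) z^m / m). *)
Definition E (c : F) (t : int) (r : int) : V -> V :=
  expo (fun m w => c *: A (t * m%:Z) w) r.

Fact E_arg_lin (c : F) (t : int) (m : nat) :
  linear (fun w : V => c *: A (t * m%:Z) w).
Proof. by move=> a u v; rewrite linearP scalerDr !scalerA mulrC. Qed.

HB.instance Definition _ c t r :=
  GRing.isLinear.Build F V V _ (E c t r) (expo_lin (E_arg_lin c t) r).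

Lemma E0 c t v : E c t 0 v = v. Proof. by []. Qed.
Lemma E_neg c t r v : r < 0 -> E c t r v = 0. Proof. exact: expo_neg. Qed.

Lemma E_rec c t (r : int) v N : (r <= N%:Z) ->
  r%:~R *: E c t r v = \sum_(m < N) c *: A (t * m.+1%:Z) (E c t (r - m.+1%:Z) v).
Proof. by move=> rN; rewrite (expo_rec (E_arg_lin c t) _ rN). Qed.

(** Only the term t m = -p of the exponent fails to commute with A_p; its bracket is the scalar -t c
    kap z^|p|, hence one correction with r lowered by |p|. The condition on t covers annihilation (t
    = 1) and creation (t = -1) at once. *)
Lemma E_comm c t p r v : t * t = 1 ->
  A p (E c t r v) = E c t r (A p v) +
    (if t * p < 0 then - t%:~R * c * kap else 0) *: E c t (r - (absz p)%:Z) v.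
Proof.
move=> tt; set d := (if _ then _ else _).
elim/expo_ind: r => [r r0||r r0 IH].
- by rewrite !E_neg ?raddf0 ?scaler0 ?addr0 //; lia.
- rewrite !E0 {}/d; case: ifP => [tp|_]; last by rewrite scale0r addr0.
  by rewrite E_neg ?scaler0 ?addr0 //; lia.
pose N := (absz r + absz p)%N.
apply: (scaler_intI r0); rewrite scalerDr scalerA mulrC -scalerA.
rewrite -[in LHS]linearZ /= !(@E_rec c t r _ N); try by rewrite /N; lia.
(* Splitting r as |p| + (r - |p|) lets the recursion expand the second part; the first is what the
   brackets of A_p with A_(t m) supply. *)
have -> : r%:~R *: E c t (r - (absz p)%:Z) v =
  (absz p)%:R *: E c t (r - (absz p)%:Z) v +
  \sum_(m < N) c *: A (t * m.+1%:Z) (E c t (r - (absz p)%:Z - m.+1%:Z) v).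
  rewrite -E_rec; last by rewrite /N; lia.
  by rewrite -scalerDl rmorphB /= addrCA subrr addr0.
rewrite scalerDr addrCA scaler_sumr -big_split raddf_sum /=.
rewrite (eq_bigr (fun m : 'I_N =>
   (if p + t * m.+1%:Z == 0 then c * p%:~R * kap else 0) *: E c t (r - m.+1%:Z) v +
   (c *: A (t * m.+1%:Z) (E c t (r - m.+1%:Z) (A p v)) +
    d *: (c *: A (t * m.+1%:Z) (E c t (r - (absz p)%:Z - m.+1%:Z) v)))));
  last first.
  move=> m _; rewrite linearZ /= heisenberg IH; last by lia.
  rewrite AD AZ !scalerDr addrC; congr (_ + (_ + _)).
    by case: ifP => _; rewrite ?scale0r ?scaler0 // scalerA mulrA.
  rewrite !scalerA mulrC; congr (_ *: A _ (E _ _ _ _)); lia.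
rewrite big_split /=; congr (_ + _); rewrite /d {IH d}.
case: ifP => [tp|/negbT]; last first.
  rewrite -leNgt => tp; rewrite scale0r big1 // => m _; case: eqP; last by rewrite scale0r.
  by move=> e; exfalso; nia.
have [j pj] : exists j : nat, p = - (t * j.+1%:Z).
  exists (absz p).-1; have [h|h] : t = 1 \/ t = -1 by nia.
    by rewrite h in tp *; lia.
  by rewrite h in tp *; lia.
have pE : absz p = j.+1.
  have [h|h] : t = 1 \/ t = -1 by nia.
    by rewrite pj h; lia.
  by rewrite pj h; lia.
have jN : (j < N)%N by rewrite /N pE; lia.
rewrite (bigD1 (Ordinal jN)) //= big1 ?addr0 => [|i ne]; last first.
  case: eqP => [e|_]; last by rewrite scale0r.
  case/eqP: ne; apply/val_inj => /=.
  have : t * (i.+1%:Z - j.+1%:Z) = 0 by rewrite -e pj; ring.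
  by move/eqP; rewrite mulf_eq0 => /orP[/eqP h|/eqP]; nia.
have -> : p + t * j.+1%:Z == 0 by rewrite pj addNr.
rewrite scalerA pE; congr (_ *: _); rewrite pj rmorphN rmorphM /=; ring.
Qed.

Lemma homog_E c t r d b v : homog d b v -> homog (d - t * r) b (E c t r v).
Proof.
move=> hv; elim/expo_ind: r => [r r0||r r0 IH].
- by rewrite E_neg //; apply: homog0.
- by rewrite E0 mulr0 subr0.
have -> : E c t r v = (r%:~R)^-1 *: (r%:~R *: E c t r v).
  by rewrite scalerA mulVf ?scale1r // intr_eq0 gt_eqF.
apply: homogZ; rewrite (@E_rec c t r v (absz r)); last by lia.
apply: homog_sum => m _; apply: homogZ.
have -> : d - t * r = d - t * (r - m.+1%:Z) - t * m.+1%:Z by ring.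
by apply/homog_A/IH; lia.
Qed.

Arguments homog_E c t r {d b v} _ _ _.

Lemma E_c0 t r v : E 0 t r v = if r == 0 then v else 0.
Proof.
case: (ltgtP r 0) => [r0|r0|->]; [exact: E_neg| | by []].
apply: (scaler_intI r0); rewrite (@E_rec 0 t r v (absz r)); last by lia.
by rewrite scaler0 big1 // => m _; rewrite scale0r.
Qed.

(** With beta = a alpha, [S] and [T] are the coefficients of z^r in E^-(-beta, z) and of z^(-q) in
    E^+(-beta, z). *)
Definition S (a r : int) : V -> V := E a%:~R (-1) r.
Definition T (a q : int) : V -> V := E (- a%:~R) 1 q.
HB.instance Definition _ a r := GRing.Linear.on (S a r).
HB.instance Definition _ a r := GRing.Linear.on (T a r).

Lemma A_S p a r v : A p (S a r v) =
  S a r (A p v) + (if 0 < p then kap * a%:~R else 0) *: S a (r - p) v.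
Proof.
rewrite E_comm; last by ring.
rewrite mulN1r oppr_lt0; case: ltrP => h; last by rewrite !scale0r.
by congr (_ + _ *: E _ _ _ _); [ring | lia].
Qed.

Lemma A_T p a q v : A p (T a q v) =
  T a q (A p v) + (if p < 0 then kap * a%:~R else 0) *: T a (q + p) v.
Proof.
rewrite E_comm ?mulr1 // mul1r; case: ltrP => h; last by rewrite !scale0r.
by congr (_ + _ *: E _ _ _ _); [ring | lia].
Qed.

Lemma homog_S a r d b v : homog d b v -> homog (d + r) b (S a r v).
Proof. by move/(homog_E a%:~R (-1) r); rewrite mulN1r opprK. Qed.

Lemma homog_T a q d b v : homog d b v -> homog (d - q) b (T a q v).
Proof. by move/(homog_E (- a%:~R) 1 q); rewrite mul1r. Qed.

Arguments homog_S a r {d b v} _ _ _.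
Arguments homog_T a q {d b v} _ _ _.

Lemma T_trunc a q d b v : homog d b v -> d < q -> T a q v = 0.
Proof. by move=> /(homog_T a q) /homog_neg h dq; apply: h; lia. Qed.

(** The term where E^+ contributes z^(-q): the powers z^r of E^- and z^<a alpha, b alpha> must
    complete it to z^(-n-1), which fixes r. *)
Definition eterm (a n b : int) (v : V) (q : int) : V :=
  S a (q - form k a b - n - 1) (T a q (sh a v)).

Lemma zfin_eterm a n d b b' v : homog d b v -> zfin (eterm a n b' v).
Proof.
move=> hv; exists (absz d).+1 => q hq; rewrite /eterm.
suff -> : T a q (sh a v) = 0 by rewrite raddf0.
have [q0|q0] := ltrP q 0; first by rewrite /T E_neg.
by apply: T_trunc (homog_sh a hv) _; lia.
Qed.

Definition e (a n : int) : V -> V :=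
  lift (fun c : K => zs (eterm a n c.2 (bas c))).
HB.instance Definition _ a n := GRing.Linear.on (e a n).

Lemma e_homog a n d b v : homog d b v -> e a n v = zs (eterm a n b v).
Proof.
move: v; apply: homog_ind => [|c M v hM hv IH].
  rewrite raddf0 /= (eq_zs (g := fun _ => 0)) ?zs0 // => q.
  by rewrite /eterm !raddf0.
have hm : homog (wtm M)%:Z b (bas (M, b)) by apply: homog_bas.
have zm := zfin_eterm a n b hm; have zv := zfin_eterm a n b hv.
rewrite linearP /= IH /e liftU -[c *: zs _](zs_lin ( *:%R c)) //.
rewrite -zsD //; last exact: zfin_lin.
by apply: eq_zs => q; rewrite /eterm /= !linearP.
Qed.

Lemma homog_e a n d b v : homog d b v ->
  homog (d - form k a b - n - 1) (a + b) (e a n v).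
Proof.
move=> hv; rewrite (e_homog a n hv); apply: homog_zs => q.
have -> : d - form k a b - n - 1 = d - q + (q - form k a b - n - 1) by lia.
exact/homog_S/homog_T/homog_sh.
Qed.

Arguments homog_e a n {d b v} _ _ _.

Lemma e_trunc a n d b v : homog d b v -> d - form k a b - n - 1 < 0 ->
  e a n v = 0.
Proof. by move=> /(homog_e a n)/homog_neg h /h. Qed.

(** The bracket arises from [T] for p < 0, from [S] for p > 0 and from the charge shift for p =
    0. *)
Lemma A_e p a n v :
  A p (e a n v) = e a n (A p v) + (kap * a%:~R) *: e a (n + p) v.
Proof.
elim/VL_ind: v => [|c [M b] v IH]; first by rewrite !raddf0 addr0.
rewrite !linearP /= IH.
suff -> : A p (e a n (bas (M, b))) = e a n (A p (bas (M, b))) +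
    (kap * a%:~R) *: e a (n + p) (bas (M, b)).
  by rewrite !scalerDr -!addrA; congr (_ + _); rewrite addrCA.
move: (bas (M, b)) (homog_bas M b) => {IH c}w; move: (wtm M)%:Z => d hw.
rewrite (e_homog a n hw) (e_homog a n (homog_A p hw)).
rewrite (e_homog a (n + p) hw).
have zw m := zfin_eterm a m b hw.
have zAw m := zfin_eterm a m b (homog_A p hw).
rewrite -(zs_lin (A p) (zw n)) -[_ *: zs _](zs_lin ( *:%R _)) //.
case: (ltgtP p 0) => [p0|p0|p0].
(* [T] returns the index q + p, so the correction matches after its sum is shifted by p. *)
- rewrite -[X in _ + X](zs_shift p); last exact: zfin_lin.
  rewrite -zsD //; last first.
    exact: (zfin_shift p (zfin_lin ( *:%R (kap * a%:~R)) (zw (n + p)))).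
  apply: eq_zs => q; rewrite /eterm /= A_S A_T A_sh.
  rewrite (lt_eqF p0) p0 ltNge (ltW p0) /= !scale0r !addr0.
  by rewrite linearD linearZ /=; congr (_ + _ *: S _ _ _); lia.
- rewrite -zsD //; last exact: zfin_lin.
  apply: eq_zs => q; rewrite /eterm /= A_S A_T A_sh.
  rewrite (gt_eqF p0) p0 ltNge (ltW p0) /= !scale0r !addr0.
  by congr (_ + _ *: S _ _ _); lia.
- rewrite -zsD //; last exact: zfin_lin.
  apply: eq_zs => q; rewrite /eterm /= A_S A_T A_sh p0 ltxx eqxx !scale0r !addr0.
  by rewrite linearD linearZ linearD linearZ.
Qed.

Lemma e0 n v : e 0 n v = if n == -1 then v else 0.
Proof.
elim/VL_ind: v => [|c [M b] v IH]; first by rewrite raddf0 if_same.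
rewrite linearP /= IH.
suff -> : e 0 n (bas (M, b)) = if n == -1 then bas (M, b) else 0.
  by case: ifP => // _; rewrite scaler0 addr0.
rewrite (e_homog 0 n (homog_bas M b)) (zs1 (d := 0)); last first.
  move=> q q0; rewrite /eterm /T mulr0z oppr0 E_c0 (negbTE q0).
  exact: raddf0.
rewrite /eterm /S /T mulr0z oppr0 !E_c0 eqxx shU /=.
have -> : form k 0 b = 0 by rewrite /Defs.form; lia.
congr (if _ then bas _ else _); last by rewrite add0r.
by apply/eqP/eqP; lia.
Qed.

(** * Normally ordered products *)

Definition is_field (w : int -> V -> V) :=
  (forall n, linear (w n)) /\
  (forall v, exists N : int, forall n, N <= n -> w n v = 0).

Lemma is_fieldP (w : int -> V -> V) : (forall n, linear (w n)) ->
  (forall M b, exists N : int, forall n, N <= n -> w n (bas (M, b)) = 0) ->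
  is_field w.
Proof.
move=> wl wb; split => // v.
elim/VL_ind: v => [|c [M b] v [N hN]].
  exists 0 => n _; have := wl n (-1) 0 0.
  by rewrite scaler0 addr0 scaleN1r addNr.
have [N' hN'] := wb M b; exists (Num.max N N') => n.
rewrite ge_max => /andP[h h']; rewrite wl hN ?hN' //.
by rewrite scaler0 addr0.
Qed.

Lemma field_A : is_field A.
Proof.
apply: is_fieldP => [n|M b]; first exact: linearP.
exists ((wtm M)%:Z + 1) => n hn.
by apply: homog_neg (homog_A n (homog_bas M b)); lia.
Qed.

Lemma field_e a : is_field (@e a).
Proof.
apply: is_fieldP => [n|M b]; first exact: linearP.
exists ((wtm M)%:Z - form k a b) => n hn.
by apply: e_trunc (homog_bas M b) _; lia.
Qed.

Lemma ex_bound (P : nat -> int -> Prop) :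
  (forall i, exists N : int, forall n, N <= n -> P i n) ->
  forall I : nat, exists N : int, forall n, N <= n -> forall i, (i < I)%N -> P i n.
Proof.
move=> h; elim=> [|I [N hN]]; first by exists 0.
have [N' hN'] := h I; exists (Num.max N N') => n.
rewrite ge_max => /andP[h1 h2] i; rewrite ltnS leq_eqVlt => /orP[/eqP->|].
  exact: hN'.
exact: hN.
Qed.

Section OneField.
Variable w : int -> V -> V.
Hypothesis wf : is_field w.
HB.instance Definition _ n := GRing.isLinear.Build F V V _ (w n) (wf.1 n).

Lemma A_trunc v : exists N : nat, forall i, N%:Z <= i -> A i v = 0.
Proof.
have [N hN] := field_A.2 v; exists (absz N) => i hi; apply: hN; lia.
Qed.

(* The bound on [n] is uniform in [i] because only finitely many [A i v] are nonzero. *)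
Lemma field_trunc v :
  exists N : nat, forall n i, N%:Z <= n -> 0 <= i -> w n (A i v) = 0.
Proof.
have [I hI] := A_trunc v.
have [i|N hN] := @ex_bound (fun i n => w n (A i%:Z v) = 0) _ I.
  exact: wf.2.
exists (absz N) => n [] // i hn _; have [h|h] := ltnP i I.
  by apply: hN => //; lia.
by rewrite hI ?raddf0 //; lia.
Qed.

Lemma field_trunc1 v : exists N : nat, forall n, N%:Z <= n -> w n v = 0.
Proof. by have [N hN] := wf.2 v; exists (absz N) => n hn; apply: hN; lia. Qed.

End OneField.

(* Creation operators are placed to the left of [w], annihilation operators
   to the right, so that [NO P w W] is sum_c P(c) :A_(-c) w_(c-W):. *)
Definition nterm (w : int -> V -> V) (W : int) (v : V) (c : int) : V :=
  if 0 < c then A (- c) (w (c - W) v) else w (c - W) (A (- c) v).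

Lemma nterm_pos w W v c : 0 < c -> nterm w W v c = A (- c) (w (c - W) v).
Proof. by rewrite /nterm => ->. Qed.

Lemma nterm_npos w W v c : c <= 0 -> nterm w W v c = w (c - W) (A (- c) v).
Proof. by rewrite /nterm leNgt => /negbTE->. Qed.

Definition NO (P : int -> F) (w : int -> V -> V) (W : int) (v : V) : V :=
  zs (fun c => P c *: nterm w W v c).

Lemma eq_NO P P' w w' W v : P =1 P' -> (forall n u, w n u = w' n u) ->
  NO P w W v = NO P' w' W v.
Proof.
by move=> PP ww; apply: eq_zs => c; rewrite PP /nterm; case: ifP; rewrite !ww.
Qed.

Section NOField.
Variable w : int -> V -> V.
Hypothesis wf : is_field w.
HB.instance Definition _ n := GRing.isLinear.Build F V V _ (w n) (wf.1 n).

Lemma zfin_nterm W v : zfin (nterm w W v).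
Proof.
have [I hI] := A_trunc v; have [N hN] := field_trunc1 wf v.
exists (I + N + absz W)%N => c hc; rewrite /nterm; case: ifP => c0.
  by rewrite hN ?raddf0 //; lia.
by rewrite hI ?raddf0 //; lia.
Qed.

Fact nterm_lin W c : linear (fun v => nterm w W v c).
Proof. by move=> a u v; rewrite /nterm; case: ifP; rewrite !linearP. Qed.

Fact NO_lin P W : linear (NO P w W).
Proof.
move=> a u v; rewrite /NO -[a *: zs _](zs_lin ( *:%R a)); last exact/zfinZ/zfin_nterm.
rewrite -zsD; first last.
- exact/zfinZ/zfin_nterm.
- exact/(zfin_lin ( *:%R a))/zfinZ/zfin_nterm.
by apply: eq_zs => c; rewrite nterm_lin scalerDr /= !scalerA mulrC.
Qed.

Lemma field_NO P h : is_field (fun n => NO P w (h - n)).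
Proof.
split=> [n|v]; first exact: NO_lin.
have [N hN] := field_trunc1 wf v; have [I hI] := A_trunc v.
have [N' hN'] := field_trunc wf v.
exists ((N + N' + I)%N%:Z + h) => n hn; rewrite /NO -[RHS](@zs0 V).
apply: eq_zs => c; rewrite /nterm; case: ifP => c0.
  by rewrite hN ?raddf0 ?scaler0 //; lia.
have [h1|h1] := leP (I%:Z) (- c); first by rewrite hI ?raddf0 ?scaler0.
by rewrite hN' ?scaler0 //; lia.
Qed.

Lemma homog_NO P d b d' b' W v :
  (forall n d0 x, homog d0 b x -> homog (d0 + d' - n) b' (w n x)) ->
  homog d b v -> homog (d + d' + W) b' (NO P w W v).
Proof.
move=> hw hv; apply: homog_zs => c; apply: homogZ; rewrite /nterm; case: ifP => c0.
  have -> : d + d' + W = d + d' - (c - W) - - c by lia.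
  exact/homog_A/hw.
have -> : d + d' + W = (d - - c) + d' - (c - W) by lia.
exact/hw/homog_A.
Qed.

Lemma NO_addP P Q W v : NO (fun c => P c + Q c) w W v = NO P w W v + NO Q w W v.
Proof.
rewrite /NO -zsD; try exact/zfinZ/zfin_nterm.
by apply: eq_zs => c; rewrite scalerDl.
Qed.

Lemma NO_scaleP a P W v : NO (fun c => a * P c) w W v = a *: NO P w W v.
Proof.
rewrite /NO -[a *: zs _](zs_lin ( *:%R a)); last exact/zfinZ/zfin_nterm.
by apply: eq_zs => c; rewrite /= scalerA.
Qed.

Let nn W c d v : V :=
  if 0 < c then A (- c) (nterm w (W - c) v d) else nterm w (W - c) (A (- c) v) d.

(** Two Heisenberg modes meet only on the same side of w, and two creation modes commute, as do two
    modes of index >= 0. *)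
Let nnC W c d v : nn W c d v = nn W d c v.
Proof.
have comm1 p q x : 0 < p -> 0 < q -> A (- p) (A (- q) x) = A (- q) (A (- p) x).
  move=> p0 q0; rewrite heisenberg; case: eqP; first by lia.
  by rewrite scale0r addr0.
have comm2 p q x : p <= 0 -> q <= 0 -> A (- p) (A (- q) x) = A (- q) (A (- p) x).
  move=> p0 q0; rewrite heisenberg; case: eqP => [h|]; last by rewrite scale0r addr0.
  have -> : p = 0 by lia.
  by rewrite oppr0 mulr0z mul0r scale0r addr0.
have -> : nn W c d v = if 0 < c then
    if 0 < d then A (- c) (A (- d) (w (c + d - W) v))
    else A (- c) (w (c + d - W) (A (- d) v))
  else if 0 < d then A (- d) (w (c + d - W) (A (- c) v))
    else w (c + d - W) (A (- d) (A (- c) v)).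
  rewrite /nn /nterm; have -> : d - (W - c) = c + d - W by lia.
  by case: ifP => // _; case: ifP.
rewrite /nn /nterm; have -> : c - (W - d) = c + d - W by lia.
case: (ltrP 0 c) => c0; case: (ltrP 0 d) => d0 //; first by rewrite (comm1 c d).
by rewrite (comm2 d c).
Qed.

(** The purpose is [Mo_perm]: modes of a monomial do not depend on the order of its factors, hence
    descend to multisets. *)
Lemma NO_comm P Q h h' n v :
  NO P (fun m => NO Q w (h' - m)) (h - n) v =
  NO Q (fun m => NO P w (h - m)) (h' - n) v.
Proof.
pose f P Q c d := (P c * Q d) *: nn (h + h' - n) c d v.
have zn Q' W u : zfin (fun d => Q' d *: nterm w W u d).
  exact/zfinZ/zfin_nterm.
have step P' Q' h1 h2 : h1 + h2 = h + h' ->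
    NO P' (fun m => NO Q' w (h2 - m)) (h1 - n) v = zs (fun c => zs (f P' Q' c)).
  move=> hh; apply: eq_zs => c; rewrite /f /nterm /NO.
  have -> : h2 - (c - (h1 - n)) = h + h' - n - c by lia.
  case: ifP => c0.
    rewrite -(zs_lin (A (- c)) (zn _ _ _)).
    rewrite -[_ *: zs _](zs_lin ( *:%R (P' c)) (zfin_lin (A (- c)) (zn _ _ _))).
    by apply: eq_zs => d; rewrite /= linearZ /= scalerA /nn c0.
  rewrite -[_ *: zs _](zs_lin ( *:%R (P' c)) (zn _ _ _)).
  by apply: eq_zs => d; rewrite /= scalerA /nn c0.
rewrite (step P Q) // (step Q P); last by rewrite addrC.
have [N hN] := field_trunc1 wf v; have [I hI] := A_trunc v.
have [N' hN'] := field_trunc wf v.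
pose B := (N + N' + I + absz (h + h' - n)%R + 1)%N.
have bnd c d : (B <= absz c)%N -> nn (h + h' - n) c d v = 0.
  rewrite /B /nn /nterm => hc; have [c0|c0] := ltrP 0 c; last first.
    by rewrite hI ?raddf0 ?if_same //; lia.
  have [d0|d0] := ltrP 0 d; first by rewrite hN ?raddf0 //; lia.
  have [h1|h1] := leP (I%:Z) (- d); first by rewrite hI ?raddf0.
  by rewrite hN' ?raddf0 //; lia.
rewrite (@zs_exchange _ _ B).
- by apply: eq_zs => d; apply: eq_zs => c; rewrite /f nnC mulrC.
- by move=> c d hc; rewrite /f bnd ?scaler0.
- by move=> c d hc; rewrite /f nnC bnd ?scaler0.
Qed.

End NOField.

(* The binomial coefficient C(c - 1, j), for c of either sign. *)
Definition bin (j : nat) (c : int) : F :=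
  if 0 < c then ('C(absz (c - 1), j))%:R else (-1) ^+ j * ('C(j + absz c, j))%:R.

(** The two sums of [mode] merged into one over c: c = j+1+i gives the creation terms, c = -i the
    annihilation terms. *)
Fixpoint Mo (s : seq nat) (a n : int) (v : V) : V :=
  match s with
  | [::] => @e a n v
  | j :: s' => NO (bin j) (Mo s' a) (j.+1%:Z - n) v
  end.

Lemma field_Mo s a : is_field (Mo s a).
Proof. by elim: s => [|j s IH]; [exact: field_e | exact: field_NO]. Qed.

HB.instance Definition _ s a n :=
  GRing.isLinear.Build F V V _ (Mo s a n) ((field_Mo s a).1 n).

Lemma homog_Mo s a n d b v : homog d b v ->
  homog (d + (wt s)%:Z - form k a b - n - 1) (a + b) (Mo s a n v).
Proof.
elim: s n d v => [|j s IH] n d v hv.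
  by rewrite /wt /= addr0; apply: homog_e.
have -> : d + (wt (j :: s))%:Z - form k a b - n - 1 =
  d + ((wt s)%:Z - form k a b - 1) + (j.+1%:Z - n) by rewrite /wt /=; lia.
apply: homog_NO hv => m d0 x hx.
have -> : d0 + ((wt s)%:Z - form k a b - 1) - m =
  d0 + (wt s)%:Z - form k a b - m - 1 by lia.
exact: IH.
Qed.

Lemma Mo_perm s t a n v : perm_eq s t -> Mo s a n v = Mo t a n v.
Proof.
have mid x t1 t2 m u : Mo (t1 ++ x :: t2) a m u = Mo (x :: t1 ++ t2) a m u.
  elim: t1 m u => [//|y t1 IH] m u.
  transitivity (Mo (y :: x :: t1 ++ t2) a m u); first exact: eq_NO.
  exact: (NO_comm (field_Mo (t1 ++ t2) a)).
elim: s t n v => [|x s IH] t n v st.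
  by move: (perm_size st) => /esym/size0nil ->.
have xt : x \in t by rewrite -(perm_mem st) mem_head.
case/splitPr: xt st => t1 t2; rewrite perm_sym perm_catC /= perm_cons.
rewrite perm_catC perm_sym => /IH h; rewrite mid; exact: eq_NO.
Qed.

(** * Comparison with the concrete lattice vertex algebra *)

Definition phi (v : vec F) : V := \sum_(x <- v) x.1 *: mon x.2.1 x.2.2.

Lemma phi_nil : phi [::] = 0. Proof. exact: big_nil. Qed.

Lemma phi1 c s b : phi [:: (c, (s, b))] = c *: mon s b.
Proof. exact: big_seq1. Qed.

Lemma phi_cat v w : phi (v ++ w) = phi v + phi w.
Proof. exact: big_cat. Qed.

Lemma phi_scale c v : phi (scalev c v) = c *: phi v.
Proof.
by rewrite /phi big_map scaler_sumr; apply: eq_bigr => x _; rewrite scalerA.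
Qed.

Lemma phi_flatten (I : Type) (f : I -> vec F) r :
  phi (flatten [seq f i | i <- r]) = \sum_(i <- r) phi (f i).
Proof.
elim: r => [|i r IH]; first by rewrite big_nil phi_nil.
by rewrite /= phi_cat IH big_cons.
Qed.

Lemma coeff_phi v b : coeff v b = vcoord (seq_mset b.1, b.2) (phi v).
Proof.
rewrite /phi raddf_sum /coeff big_mkcond; apply: eq_bigr => x _ /=.
rewrite linearZ /= vcoordU xpair_eqE.
have -> : (seq_mset x.2.1 == seq_mset b.1) = perm_eq x.2.1 b.1.
  by apply/eqP/idP => [/eq_seq_msetP //|h]; apply/eq_seq_msetP.
by case: ifP; rewrite ?mulr1 ?mulr0.
Qed.

Lemma veqP v w : veq v w <-> phi v = phi w.
Proof.
split=> [vw|vw b]; last by rewrite !coeff_phi vw.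
apply: vcoord_inj => -[M b]; have := vw (mseq M, b).
by rewrite !coeff_phi /= mseqK.
Qed.

Lemma phi_onto x : exists v, phi v = x.
Proof.
elim/VL_ind: x => [|c [M b] x [v vx]]; first by exists [::]; rewrite phi_nil.
exists ((c, (mseq M, b)) :: v).
by rewrite -cat1s phi_cat phi1 vx /mon mseqK.
Qed.

Lemma phi_linext (h : {linear V -> V}) (f : basis -> vec F) v :
  (forall b, phi (f b) = h (mon b.1 b.2)) -> phi (linext f v) = h (phi v).
Proof.
move=> hf; rewrite /linext phi_flatten [in RHS]/phi raddf_sum.
by apply: eq_bigr => x _; rewrite /= phi_scale hf linearZ.
Qed.

Lemma mset_splice (s : seq nat) i p : (i < size s)%N -> nth 0%N s i = p ->
  seq_mset (take i s ++ drop i.+1 s) = (seq_mset s `\ p)%mset.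
Proof.
move=> si <-; apply/msetP => r; rewrite msetB1E !mset_seqE.
have -> : count_mem r (take i s ++ drop i.+1 s) =
  (count_mem r (take i s) + count_mem r (drop i.+1 s))%N by exact: count_cat.
have -> : count_mem r s =
  (count_mem r (take i s) + ((nth 0 s i == r) + count_mem r (drop i.+1 s)))%N.
  by rewrite -{1}(cat_take_drop i s) (drop_nth 0%N si); exact: count_cat.
by rewrite addnCA [r == _]eq_sym addKn.
Qed.

Lemma phi_alpha n b : phi (alpha F k n b) = A n (mon b.1 b.2).
Proof.
case: b => s b; case: n => [[|p]|p] /=.
- by rewrite phi1 A0_mon formE mulr1.
- rewrite phi_flatten /mon AU /Ab /=.
  rewrite (eq_big_seq (fun i => if nth 0%N s i == p then
    (p.+1%:R * kap) *: bas ((seq_mset s `\ p)%mset, b) else 0)); last first.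
    move=> i; rewrite mem_iota add0n => si; case: eqP => [e|_]; last exact: phi_nil.
    by rewrite phi1 intrM /mon (mset_splice si e).
  rewrite -big_mkcond /= big_const_seq iter_addr_0.
  have -> : count (fun i => nth 0%N s i == p) (iota 0 (size s)) = seq_mset s p.
    rewrite mset_seqE -[in RHS](mkseq_nth 0%N s) /mkseq count_map.
    exact: eq_count.
  by rewrite -scaler_nat scalerA mulrC.
- by rewrite phi1 scale1r A_mon.
Qed.

Lemma phi_alphav n v : phi (alphav k n v) = A n (phi v).
Proof. exact/phi_linext/phi_alpha. Qed.

Lemma phi_expc (x : nat -> vec F -> vec F) x' r v :
  (forall m v, phi (x m.+1 v) = x' m.+1 (phi v)) ->
  phi (expc x r v) = expo x' r%:Z (phi v).
Proof.
move=> hx; have h : [seq phi u | u <- expl x r v] = exps x' r (phi v).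
  elim: r => [//|r IH].
  have -> : expl x r.+1 v = scalev (r.+1%:R)^-1 (flatten
      [seq x m.+1 (nth [::] (expl x r v) m) | m <- iota 0 r.+1]) :: expl x r v.
    by [].
  have -> : exps x' r.+1 (phi v) = (r.+1%:R)^-1 *: (\sum_(m < r.+1)
      x' m.+1 (nth 0 (exps x' r (phi v)) m)) :: exps x' r (phi v).
    by [].
  rewrite map_cons phi_scale phi_flatten IH; congr (_ *: _ :: _).
  rewrite -[iota 0 r.+1]/(index_iota 0 r.+1) big_mkord; apply: eq_bigr => m _.
  rewrite hx -IH; congr (x' _ _).
  have [h|h] := ltnP m (size (expl x r v)); first by rewrite (nth_map [::]).
  by rewrite !nth_default ?size_map ?phi_nil.
rewrite /expc /expo -h; case: (expl x r v) => //=; exact: phi_nil.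
Qed.

Lemma phi_Em a r v : phi (Em k a r v) = S a r%:Z (phi v).
Proof.
apply: phi_expc => m u; rewrite phi_scale phi_alphav mulN1r.
by congr (_ *: A _ _); lia.
Qed.

Lemma phi_Ep a r v : phi (Ep k a r v) = T a r%:Z (phi v).
Proof. by apply: phi_expc => m u; rewrite phi_scale phi_alphav mul1r. Qed.

Lemma homog_mon s b : homog (wt s)%:Z b (mon s b).
Proof. by rewrite -wtm_seq; apply: homog_bas. Qed.
Arguments homog_mon : clear implicits.

Lemma phi_mode s a n b : phi (mode F k s a n b) = Mo s a n (mon b.1 b.2).
Proof.
elim: s n b => [|j s IH] n [t b]; rewrite [(t, b).1]/= [(t, b).2]/=.
  have hm := homog_mon t b.
  rewrite [Mo _ _ _ _]/= (e_homog a n hm) (@zs_nat _ _ (wt t).+1); first last.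
  - move=> q hq; rewrite /eterm (@T_trunc a q _ _ _ (homog_sh a hm)) ?raddf0 //; lia.
  - by move=> q hq; rewrite /eterm /T E_neg // raddf0.
  rewrite /mode /mode_e phi_flatten [(t, b).1]/=.
  rewrite -[iota 0 _]/(index_iota 0 (wt t).+1) big_mkord; apply: eq_bigr => q _ /=.
  rewrite /eterm /mon shU; case: lerP => hr; last by rewrite phi_nil /S E_neg.
  by rewrite phi_Em phi_Ep phi1 scale1r gez0_abs.
have -> : mode F k (j :: s) a n (t, b) =
  let B : int := (wt s + wt t + absz (form k a b))%N in
  flatten [seq scalev ('C(j + i, i))%:R
             (alphav k (Negz (j + i)) (mode F k s a (n + i%:Z) (t, b)))
          | i <- iota 0 (absz (B - n)).+1] ++
  flatten [seq scalev ((-1) ^+ (j.+2) * ('C(j + i, i))%:R)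
             (linext (mode F k s a (n - (j.+1)%:Z - i%:Z))
                (alpha F k (Posz i) (t, b)))
          | i <- iota 0 (wt t).+1] by [].
cbv zeta; rewrite phi_cat !phi_flatten.
rewrite -[iota 0 (wt t).+1]/(index_iota 0 (wt t).+1).
set N := (absz _).+1; rewrite -[iota 0 N]/(index_iota 0 N) !big_mkord.
have hm := homog_mon t b.
rewrite [Mo _ _ _ _]/= /NO (@zs_split _ _ j%:Z N (wt t).+1) //; first last.
- move=> c hc c0; rewrite /nterm ltNge c0 /=.
  have -> : A (- c) (mon t b) = 0.
    by apply: homog_neg (homog_A (- c) hm); lia.
  by rewrite raddf0 scaler0.
- move=> c hc c0; rewrite /nterm c0.
  have -> : Mo s a (c - (j.+1%:Z - n)) (mon t b) = 0.
    by apply: homog_neg (@homog_Mo s a _ _ _ _ hm); move: hc; rewrite /N; lia.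
  by rewrite raddf0 scaler0.
- move=> c hc; rewrite /bin ifT; last by lia.
  by rewrite bin_small ?scale0r //; lia.
congr (_ + _); apply: eq_bigr => i _; rewrite phi_scale /nterm /bin.
- have -> : 0 < j%:Z + 1 + i%:Z by lia.
  rewrite phi_alphav IH.
  have -> : absz (j%:Z + 1 + i%:Z - 1)%R = (j + i)%N by lia.
  have -> : - (j%:Z + 1 + i%:Z) = Negz (j + i) by lia.
  have -> : (j%:Z + 1 + i%:Z - (j.+1%:Z - n)) = n + i%:Z by lia.
  by rewrite -bin_sub ?leq_addl // addnK.
- have -> : 0 < - i%:Z = false by apply/negbTE; rewrite -leNgt; lia.
  rewrite (@phi_linext (Mo s a (n - (j.+1)%:Z - i%:Z))) => [|b']; last exact: IH.
  rewrite phi_alpha opprK abszN /=.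
  have -> : - i%:Z - (j.+1%:Z - n) = n - j.+1%:Z - i%:Z by lia.
  have -> : (-1) ^+ j.+2 = (-1) ^+ j :> F by rewrite !exprS !mulN1r opprK.
  by rewrite -bin_sub ?leq_addl // addnK.
Qed.

Definition Yr (n : int) (v : V) : V -> V :=
  lift (fun c : K => Mo (mseq c.1) c.2 n v).
HB.instance Definition _ n v := GRing.Linear.on (Yr n v).

Definition Y (n : int) (u v : V) : V := Yr n v u.

Lemma YDl n u u' v : Y n (u + u') v = Y n u v + Y n u' v.
Proof. exact: linearD. Qed.
Lemma YZl n c u v : Y n (c *: u) v = c *: Y n u v.
Proof. exact: linearZ. Qed.
Lemma Y0l n v : Y n 0 v = 0.
Proof. exact: raddf0. Qed.

Lemma Y_mon n s a v : Y n (mon s a) v = Mo s a n v.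
Proof. by rewrite /Y /Yr liftU; apply/Mo_perm/perm_eq_seq_mset. Qed.

Lemma Y_bas n M a v : Y n (bas (M, a)) v = Mo (mseq M) a n v.
Proof. exact: liftU. Qed.

Lemma field_Y u : is_field (fun n => Y n u).
Proof.
elim/VL_ind: u => [|c [M a] u [IH1 IH2]].
  split=> [n d x y|v]; first by rewrite !Y0l scaler0 addr0.
  by exists 0 => n _; rewrite Y0l.
split=> [n d x y|v].
  rewrite !YDl !YZl !Y_bas IH1 linearP !scalerDr !scalerA mulrC.
  by rewrite -!addrA; congr (_ + _); rewrite addrCA.
have [N1 h1] := IH2 v; have [N2 h2] := (@field_Mo (mseq M) a).2 v.
exists (Num.max N1 N2) => n; rewrite ge_max => /andP[n1 n2].
by rewrite YDl YZl Y_bas h1 ?h2 ?scaler0 ?addr0.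
Qed.
HB.instance Definition _ n u :=
  GRing.isLinear.Build F V V _ (Y n u) ((field_Y u).1 n).

Lemma phi_modev u n v : phi (modev k u n v) = Y n (phi u) (phi v).
Proof.
rewrite /modev -[X in flatten X]map_id phi_flatten big_allpairs_dep /=.
rewrite -[RHS]/(Yr n (phi v) (\sum_(x <- u) x.1 *: mon x.2.1 x.2.2)) raddf_sum.
apply: eq_bigr => x _ /=; rewrite linearZ /= -[Yr _ _ _]/(Y _ _ _) Y_mon.
rewrite [in RHS]/phi raddf_sum scaler_sumr.
by apply: eq_bigr => y _ /=; rewrite phi_scale phi_mode linearZ scalerA.
Qed.

(** * The involution theta and the subspace C_2 *)

Definition theta : V -> V :=
  lift (fun c : K => (-1) ^+ size (mseq c.1) *: bas (c.1, - c.2)).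
HB.instance Definition _ := GRing.Linear.on theta.

Lemma theta_mon s b : theta (mon s b) = (-1) ^+ size s *: mon s (- b).
Proof. by rewrite /theta liftU (perm_size (perm_eq_seq_mset s)). Qed.

Lemma phi_theta v : phi (thetav v) = theta (phi v).
Proof.
rewrite /phi raddf_sum /thetav big_map; apply: eq_bigr => x _ /=.
by rewrite linearZ /= theta_mon scalerA mulrC.
Qed.

Lemma in_VplusP v : in_Vplus v <-> theta (phi v) = phi v.
Proof. by rewrite -phi_theta; apply: veqP. Qed.

Lemma mon_ind (P : V -> Prop) : P 0 ->
  (forall c s b x, P x -> P (c *: mon s b + x)) -> forall x, P x.
Proof.
move=> P0 PS; apply: VL_ind => // c [M b] x Px.
by rewrite -[M]mseqK; apply: PS.
Qed.

Lemma thetaK x : theta (theta x) = x.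
Proof.
elim/mon_ind: x => [|c s b x IH]; first by rewrite !raddf0.
rewrite !linearP /= IH; congr (_ *: _ + _).
by rewrite theta_mon linearZ /= theta_mon scalerA -expr2 sqrr_sign scale1r opprK.
Qed.

Lemma sh_mon a s b : sh a (mon s b) = mon s (a + b).
Proof. exact: shU. Qed.

Lemma theta_sh a x : theta (sh a x) = sh (- a) (theta x).
Proof.
elim/mon_ind: x => [|c s b x IH]; first by rewrite !raddf0.
rewrite !linearP /= IH; congr (_ *: _ + _).
by rewrite sh_mon !theta_mon linearZ /= sh_mon opprD.
Qed.

Lemma theta_A p x : theta (A p x) = - A p (theta x).
Proof.
elim/VL_ind: x => [|c [M b] x IH]; first by rewrite !raddf0.
rewrite !linearP /= IH; congr (_ *: _ + _).
rewrite !AU {2}/theta liftU /= linearZ /= AU.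
case: p {IH} => [[|p]|p] /=.
- rewrite linearZ /= /theta liftU /= -scalerN -scaleNr !scalerA.
  by rewrite mulrNz !mulrN opprK mulrC.
- rewrite linearZ /= /theta liftU /=.
  case: (posnP (M p)) => [->|Mp]; first by rewrite mulr0 !scale0r scaler0 oppr0.
  have -> : size (mseq M) = (size (mseq (M `\ p)%mset)).+1.
    rewrite -{1}(@msetB1K _ p M) -?mset_gt0 // -[(M `\ p)%mset]mseqK.
    by rewrite -seq_mset_cons !(perm_size (perm_eq_seq_mset _)).
  by rewrite exprS mulN1r scaleNr opprK !scalerA mulrC.
- rewrite /theta liftU /=.
  have -> : size (mseq (p +` M)%mset) = (size (mseq M)).+1.
    by rewrite -{1}[M]mseqK -seq_mset_cons (perm_size (perm_eq_seq_mset _)).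
  by rewrite exprS mulN1r scaleNr.
Qed.

Lemma theta_E c t r x : theta (E c t r x) = E (- c) t r (theta x).
Proof.
elim/expo_ind: r => [r r0||r r0 IH]; first by rewrite !E_neg ?raddf0.
  by rewrite !E0.
have rN : r <= (absz r)%:Z by lia.
apply: (scaler_intI r0); rewrite -[LHS]linearZ /= !(E_rec _ _ _ rN) raddf_sum.
apply: eq_bigr => m _; rewrite /= linearZ /= theta_A IH; last by lia.
by rewrite scalerN scaleNr.
Qed.

Lemma theta_e a n x : theta (e a n x) = e (- a) n (theta x).
Proof.
elim/mon_ind: x => [|c s b x IH]; first by rewrite !raddf0.
rewrite !linearP /= IH; congr (_ *: _ + _).
have hm := @homog_mon s b; have hm' := @homog_mon s (- b).
rewrite theta_mon linearZ /= (e_homog a n hm) (e_homog (- a) n hm').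
rewrite -(zs_lin theta (zfin_eterm a n b hm)).
rewrite -[_ *: zs _](zs_lin ( *:%R _) (zfin_eterm (- a) n (- b) hm')).
apply: eq_zs => q; rewrite /eterm /= /S /T !theta_E theta_sh theta_mon.
rewrite !linearZ /= rmorphN; congr (_ *: E _ _ _ _).
by rewrite /Defs.form; lia.
Qed.

Lemma theta_Mo s a n x : theta (Mo s a n x) = (-1) ^+ size s *: Mo s (- a) n (theta x).
Proof.
elim: s n x => [|j s IH] n x; first by rewrite scale1r; apply: theta_e.
rewrite /= /NO -(zs_lin theta); last exact/zfinZ/zfin_nterm/field_Mo.
rewrite -[_ *: zs _](zs_lin ( *:%R _)); last exact/zfinZ/zfin_nterm/field_Mo.
apply: eq_zs => c; rewrite /= linearZ /= scalerA mulrC -scalerA; congr (_ *: _).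
rewrite /nterm exprS mulN1r; case: ifP => _.
  by rewrite theta_A IH linearZ scaleNr.
by rewrite IH theta_A linearN scalerN scaleNr.
Qed.

Lemma theta_Y n u x : theta (Y n u x) = Y n (theta u) (theta x).
Proof.
elim/mon_ind: u => [|c s b u IH]; first by rewrite raddf0 !Y0l raddf0.
by rewrite linearP /= !YDl !YZl linearP /= IH theta_mon YZl !Y_mon theta_Mo.
Qed.

(** Scalars are left out because u absorbs them ([C2_Z]); the constructors thus follow the lists of
    [in_C2_Vplus]. *)
Inductive C2 : V -> Prop :=
| C2_0 : C2 0
| C2_S u v x : theta u = u -> theta v = v -> C2 x -> C2 (Y (-2) u v + x).

Lemma C2_D x y : C2 x -> C2 y -> C2 (x + y).
Proof.
move=> hx hy; elim: hx => [|u v z hu hv _ IH]; first by rewrite add0r.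
by rewrite -addrA; apply: C2_S.
Qed.

Lemma C2_Z c x : C2 x -> C2 (c *: x).
Proof.
elim => [|u v z hu hv _ IH]; first by rewrite scaler0; apply: C2_0.
by rewrite scalerDr -YZl; apply: C2_S => //; rewrite linearZ /= hu.
Qed.

Lemma C2_theta x : C2 x -> theta x = x.
Proof.
elim => [|u v z hu hv _ IH]; first by rewrite raddf0.
by rewrite linearD /= theta_Y hu hv IH.
Qed.

Lemma in_C2P (w : vec F) : in_C2_Vplus k w <-> C2 (phi w).
Proof.
split=> [[l [hl /veqP ->]]|].
  elim: l hl => [|p l IH] hl; first by rewrite phi_nil; apply: C2_0.
  rewrite /= phi_cat phi_modev; have [/in_VplusP h1 /in_VplusP h2] := hl p (mem_head _ _).
  by apply: C2_S => //; apply: IH => q ql; apply: hl; rewrite inE ql orbT.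
suff H x : C2 x -> forall w, phi w = x -> in_C2_Vplus k w by move=> /H; apply.
elim=> {w} [|u v x' hu hv _ IH] w xw.
  by exists [::]; split => //; apply/veqP; rewrite xw phi_nil.
have [w' w'E] := phi_onto x'; have [u' u'E] := phi_onto u.
have [v' v'E] := phi_onto v; have [l [hl /veqP lE]] := IH _ w'E.
exists ((u', v') :: l); split=> [p|].
  rewrite inE => /orP[/eqP->|]; last exact: hl.
  by split; apply/in_VplusP; rewrite ?u'E ?v'E.
by apply/veqP; rewrite xw /= phi_cat -lE phi_modev u'E v'E w'E.
Qed.

Lemma zs_delta (c : int) (a : int -> F) (u : V) :
  zfin (fun d => (if d == c then a d else 0) *: u) /\
  zs (fun d => (if d == c then a d else 0) *: u) = a c *: u.
Proof.
split; last by rewrite (zs1 (d := c)) ?eqxx // => d /negbTE->; rewrite scale0r.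
exists (absz c).+1 => d hd; case: eqP => [h|_]; last by rewrite scale0r.
by move: hd; rewrite h; lia.
Qed.

Lemma nterm_A_comm W v c d : nterm A W (A (- c) v) d = A (- c) (nterm A W v d) +
  ((if d == - c then c%:~R * kap else 0) *: A (- (c + W)) v +
   (if d == W + c then c%:~R * kap else 0) *: A (- (c + W)) v).
Proof.
have h1 x : A (d - W) (A (- c) x) = A (- c) (A (d - W) x) +
    (if d == W + c then c%:~R * kap else 0) *: x.
  rewrite heisenberg; have -> : (d - W + - c == 0) = (d == W + c).
    by apply/eqP/eqP; lia.
  by case: eqP => // ->; rewrite addrAC subrr add0r.
have h2 x : A (- d) (A (- c) x) = A (- c) (A (- d) x) +
    (if d == - c then c%:~R * kap else 0) *: x.
  rewrite heisenberg; have -> : (- d + - c == 0) = (d == - c).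
    by apply/eqP/eqP; lia.
  by case: eqP => // ->; rewrite opprK.
rewrite /nterm; case: ifP => _.
  rewrite h1 AD AZ h2 -addrA; congr (_ + (_ + _)).
    by case: eqP => [->|_]; rewrite ?scale0r //; congr (_ *: A _ _); lia.
  by case: eqP => [->|_]; rewrite ?scale0r //; congr (_ *: A _ _); lia.
rewrite h2 AD AZ h1 -addrA; congr (_ + _); rewrite addrC; congr (_ + _).
  by case: eqP => [->|_]; rewrite ?scale0r //; congr (_ *: A _ _); lia.
by case: eqP => [->|_]; rewrite ?scale0r //; congr (_ *: A _ _); lia.
Qed.

(** A_(-c) contracts with the first factor at d = -c and with the second at d = W + c. A quadratic
    operator therefore acts on creation operators like a derivation. *)
Lemma NO_A_comm P W c v : NO P A W (A (- c) v) = A (- c) (NO P A W v) +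
  (c%:~R * kap * (P (W + c) + P (- c))) *: A (- (c + W)) v.
Proof.
set u := A (- (c + W)) v; pose ck := c%:~R * kap.
have zn x : zfin (fun d => P d *: nterm A W x d).
  exact/zfinZ/zfin_nterm/field_A.
rewrite {1 2}/NO -(zs_lin (A (- c)) (zn v)).
have [z1 s1] := zs_delta (- c) (fun d => P d * ck) u.
have [z2 s2] := zs_delta (W + c) (fun d => P d * ck) u.
rewrite -/ck mulrDr [ck * _]mulrC [ck * P (- c)]mulrC scalerDl -s1 -s2.
rewrite [X in _ + X]addrC -(zsD z1 z2).
rewrite -(zsD (zfin_lin (A (- c)) (zn v)) (zfinD z1 z2)).
apply: eq_zs => d; rewrite nterm_A_comm !scalerDr /= AZ -/u -/ck.
congr (_ + (_ + _)); rewrite scalerA; congr (_ *: _);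
  by case: ifP; rewrite ?mulr0.
Qed.

Lemma NO_vac P (W : nat) b : NO P A W%:Z (mon [::] b) =
  \sum_(c < W.+1) P c%:Z *: nterm A W%:Z (mon [::] b) c%:Z.
Proof.
rewrite /NO (@zs_nat _ _ W.+1) // => c hc; rewrite /nterm.
  by rewrite ifF ?Apos_vac ?raddf0 ?scaler0 //; lia.
by rewrite ifT ?Apos_vac ?raddf0 ?scaler0 //; lia.
Qed.

(* L(-1) = omega_0, for the conformal vector omega = alpha(-1)^2 / (2 <alpha, alpha>). *)
Definition L (v : V) : V := (kap *+ 2)^-1 *: NO (fun _ => 1) A 1 v.

Fact L_lin : linear L.
Proof.
by move=> a u v; rewrite /L (NO_lin field_A) scalerDr !scalerA mulrC.
Qed.
HB.instance Definition _ := GRing.isLinear.Build F V V _ L L_lin.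

Lemma theta_L v : theta (L v) = L (theta v).
Proof.
rewrite /L linearZ /= /NO; congr (_ *: _).
rewrite -(zs_lin theta); last exact/zfinZ/zfin_nterm/field_A.
apply: eq_zs => c; rewrite /= !scale1r /nterm.
by case: ifP => _; rewrite !theta_A linearN opprK.
Qed.

Lemma NO_linw P w w' c W v : is_field w -> is_field w' ->
  NO P (fun m x => c *: w m x + w' m x) W v = c *: NO P w W v + NO P w' W v.
Proof.
move=> fw fw'; rewrite /NO -[c *: zs _](zs_lin ( *:%R c)); last exact/zfinZ/zfin_nterm.
rewrite -zsD; last exact/zfinZ/zfin_nterm; last first.
  exact/(zfin_lin ( *:%R c))/zfinZ/zfin_nterm.
apply: eq_zs => d; rewrite /= scalerA mulrC -scalerA -scalerDr; congr (_ *: _).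
by rewrite /nterm; case: ifP => _ //; rewrite AD AZ.
Qed.

Lemma Y_X n j u v :
  Y n (A (Negz j) u) v = NO (bin j) (fun m => Y m u) (j.+1%:Z - n) v.
Proof.
elim/mon_ind: u v => [|c s b u IH] v.
  rewrite raddf0 Y0l /NO -[LHS](@zs0 V); apply: eq_zs => c.
  by rewrite /nterm !Y0l raddf0 if_same scaler0.
rewrite linearP /= YDl YZl IH A_mon Y_mon /=.
rewrite -(NO_linw _ _ _ _ (@field_Mo s b) (@field_Y u)).
by apply: eq_NO => // m x; rewrite YDl YZl Y_mon.
Qed.

Lemma bin0 c : bin 0 c = 1.
Proof. by rewrite /bin; case: ifP => _; rewrite ?bin0 ?mul1r ?expr0 ?bin0 ?mul1r. Qed.

Lemma bin_S j c : j.+1%:R * bin j.+1 c = (c - j.+1%:Z)%:~R * bin j c.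
Proof.
rewrite /bin; case: ltrP => c0.
  rewrite -natrM mul_bin_left natrM.
  have [h|h] := leqP j (absz (c - 1)%R); last first.
    by rewrite bin_small // !mulr0.
  rewrite natrB //; congr (_ * _).
  have -> : c - j.+1%:Z = (absz (c - 1)%R)%:Z - j%:Z by lia.
  by rewrite rmorphB.
have -> : (j.+1 + absz c)%N = (j + absz c).+1 by [].
set n := (j + absz c)%N.
have -> : c - j.+1%:Z = - n.+1%:Z by rewrite /n; lia.
rewrite mulrCA -natrM -mul_bin_diag natrM mulrNz exprS mulN1r !mulNr.
by rewrite mulrCA.
Qed.

Lemma bin_lt j c : 0 < c -> c <= j%:Z -> bin j c = 0.
Proof. by move=> c0 cj; rewrite /bin c0 bin_small //; lia. Qed.

Lemma bin_diag j : bin j j.+1%:Z = 1.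
Proof. by rewrite /bin /= subn1 binn. Qed.

Lemma bin_diagS j : bin j j.+2%:Z = j.+1%:R.
Proof. by rewrite /bin /= subn1 binSn. Qed.

Lemma zfin_sum (I : finType) (f : I -> int -> V) :
  (forall i, zfin (f i)) -> zfin (fun q => \sum_i f i q).
Proof.
move=> hf; elim: (index_enum I) => [|i r IH].
  by exists 0%N => c _; rewrite big_nil.
have [N hN] := zfinD (hf i) IH; exists N => c hc; rewrite big_cons; exact: hN.
Qed.

Lemma zs_sum (I : finType) (f : I -> int -> V) :
  (forall i, zfin (f i)) -> zs (fun q => \sum_i f i q) = \sum_i zs (f i).
Proof.
move=> hf; have [N hN] : exists N, forall i, zbound (f i) N.
  suff [N hN] : exists N, forall i, i \in enum I -> zbound (f i) N.
    by exists N => i; apply: hN; rewrite mem_enum.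
  elim: (enum I) => [|i r [N1 h1]]; first by exists 0%N.
  have [N2 h2] := hf i; exists (maxn N1 N2) => j; rewrite inE.
  case/orP=> [/eqP->|/h1 hj]; [exact: zboundW (leq_maxr _ _) h2 |].
  exact: zboundW (leq_maxl _ _) hj.
rewrite (@zs_eq _ _ N) => [|c hc]; last by rewrite big1 // => i _; apply: hN.
rewrite (eq_bigr (fun i => zpart (f i) N)) => [|i _]; last exact: zs_eq.
by rewrite exchange_big; apply: eq_bigr => i _; rewrite big_split.
Qed.

Lemma A0_homog d b v : homog d b v -> A 0 v = (kap * b%:~R) *: v.
Proof.
move: v; apply: homog_ind => [|c M v hM hv IH]; first by rewrite !raddf0.
by rewrite AD AZ IH AU /= scalerDr !scalerA mulrC.
Qed.

Lemma A_neg_trunc i d b v : homog d b v -> d < i -> A i v = 0.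
Proof. by move=> hv di; apply: homog_neg (homog_A i hv); lia. Qed.

(* Translation covariance a (x_1 e^a)_n = - n e^a_(n-1): both halves of the
   normal ordered product are resummed by the recursions defining S and T. *)
Lemma e_translation a n v :
  a%:~R *: NO (fun _ => 1) (e a) (1 - n) v = - n%:~R *: e a (n - 1) v.
Proof.
have fe := field_e a.
elim/mon_ind: v => [|c s b v IH].
  have := NO_lin fe (fun _ => 1) (1 - n) (-1) 0 0.
  by rewrite scaler0 addr0 scaleN1r addNr => ->; rewrite !raddf0.
rewrite (NO_lin fe) (linearP (e a (n - 1))) /= !scalerDr IH !scalerA ![_ * c]mulrC -!scalerA.
congr (c *: _ + _) => {v IH}; move: (mon s b) (@homog_mon s b) => v.
move: (wt s)%:Z => d hv; set f := form k a b.
pose N' := (absz d + absz f + absz n).+1; pose N := N'.+1.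
rewrite /NO (@zs_split _ _ 0 N N) //; first last.
- move=> c' hc c0; rewrite scale1r /nterm ltNge c0 /=.
  rewrite (@A_neg_trunc _ d b) ?raddf0 //; move: hc; rewrite /N /N'; lia.
- move=> c' hc c0; rewrite scale1r /nterm c0 (e_trunc hv) ?raddf0 //.
  by rewrite -/f; move: hc; rewrite /N /N'; lia.
- by move=> c' hc; lia.
pose g q := S a (q - f - n) (T a q (sh a v)).
have zg : zfin g.
  have := zfin_eterm a (n - 1) b hv; congr zfin.
  by apply: FunctionalExtensionality.functional_extensionality => q;
     rewrite /eterm /g -/f; congr (S _ _ _); lia.
have eg : e a (n - 1) v = zs g.
  by rewrite (e_homog a _ hv); apply: eq_zs => q; rewrite /eterm /g -/f;
     congr (S _ _ _); lia.
have hsv := homog_sh a hv.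
(* By the recursion for [S], the creation half multiplies the term of index q by its degree q - f -
   n. *)
have part1 : a%:~R *: (\sum_(i < N) 1 *: nterm (e a) (1 - n) v (0 + 1 + i%:Z)) =
    zs (fun q => (q - f - n)%:~R *: g q).
  rewrite scaler_sumr.
  rewrite (eq_bigr (fun i : 'I_N => zs (fun q => a%:~R *: A (- 1 * i.+1%:Z)
      (S a (q - f - n - i.+1%:Z) (T a q (sh a v)))))); last first.
    move=> i _; rewrite scale1r nterm_pos; last by lia.
    have ze := zfin_eterm a (0 + 1 + i%:Z - (1 - n)) b hv.
    rewrite (e_homog a _ hv) -(zs_lin (A (- (0 + 1 + i%:Z))) ze).
    rewrite -[_ *: zs _](zs_lin ( *:%R a%:~R) (zfin_lin (A (- (0 + 1 + i%:Z))) ze)).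
    apply: eq_zs => q; rewrite /eterm -/f /=.
    by congr (_ *: A _ (S _ _ _)); lia.
  rewrite -zs_sum; last first.
    move=> i; have := zfin_eterm a (0 + 1 + i%:Z - (1 - n)) b hv.
    move=> /(zfin_lin (A (- 1 * i.+1%:Z)))/(zfin_lin ( *:%R a%:~R)); congr zfin.
    apply: FunctionalExtensionality.functional_extensionality => q.
    by rewrite /eterm -/f /=; congr (_ *: A _ (S _ _ _)); lia.
  apply: eq_zs => q; have [hq|hq] := ltrP d q.
    rewrite /g (@T_trunc a q _ _ _ hsv hq) !raddf0 big1 // => i _.
    by rewrite !raddf0.
  by rewrite /g /S (@E_rec _ _ _ _ N) //; rewrite /N /N'; lia.
(* Here i = 0 is the zero mode, which gives f, and the other terms give -q by the recursion for [T];
   both halves together leave -n. *)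
have part2 : a%:~R *: (\sum_(i < N) 1 *: nterm (e a) (1 - n) v (- i%:Z)) =
    zs (fun q => (f - q)%:~R *: g q).
  pose h (i : nat) q := a%:~R *: S a (q - f - n) (A (1 * i.+1%:Z)
    (T a (q - i.+1%:Z) (sh a v))).
  have hE (i : nat) q : h i (q + i.+1%:Z) =
    a%:~R *: eterm a (- i.+1%:Z - (1 - n)) b (A i.+1%:Z v) q.
    rewrite /h /eterm -/f addrK mul1r A_T A_sh ltNge lez_nat /=.
    rewrite !scale0r !addr0; congr (_ *: S _ _ _); lia.
  have zh i : zfin (h i).
    have := zfin_eterm a (- i.+1%:Z - (1 - n)) b (homog_A i.+1%:Z hv).
    move=> /(zfin_lin ( *:%R a%:~R))/(zfin_shift (- i.+1%:Z)); congr zfin.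
    apply: FunctionalExtensionality.functional_extensionality => q /=.
    by rewrite -hE subrK.
  rewrite big_ord_recl scalerDr scaler_sumr.
  rewrite (eq_bigr (fun i : 'I_ _ => zs (h i))); last first.
    move=> i _; rewrite scale1r nterm_npos; last by rewrite /bump /=; lia.
    rewrite opprK (e_homog a _ (homog_A _ hv)) -(zs_shift i.+1%:Z (zh i)).
    rewrite -[_ *: zs _](zs_lin ( *:%R a%:~R)); last exact: zfin_eterm (homog_A _ hv).
    by apply: eq_zs => q; rewrite hE.
  rewrite -zs_sum // scale1r nterm_npos // oppr0 (A0_homog hv) linearZ /=.
  rewrite scalerA mulrA [a%:~R * _]mulrC -formE -/f sub0r opprB eg.
  have zhs : zfin (fun q => \sum_(i < N') h i q) by apply: zfin_sum => i; apply: zh.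
  rewrite -[_ *: zs _](zs_lin ( *:%R f%:~R) zg).
  rewrite -(zsD (zfin_lin ( *:%R f%:~R) zg) zhs).
  apply: eq_zs => q /=; rewrite rmorphB /= scalerBl; congr (_ + _).
  rewrite -scaleNr /g /h -[_ *: S _ _ _]linearZ /=.
  rewrite (eq_bigr (fun i : 'I_ _ => S a (q - f - n)
     (a%:~R *: A (1 * i.+1%:Z) (T a (q - i.+1%:Z) (sh a v))))) => [|i _]; last first.
    by rewrite linearZ.
  rewrite -raddf_sum; congr (S _ _ _).
  have [hq|hq] := ltrP d q.
    rewrite (@T_trunc a q _ _ _ hsv hq) raddf0 big1 // => i _.
    have hT := homog_A (1 * i.+1%:Z) (@homog_T a (q - i.+1%:Z) _ _ _ hsv).
    by rewrite (homog_neg _ hT) ?scaler0 //; lia.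
  rewrite scaleNr /T (@E_rec _ _ _ _ N'); last by rewrite /N'; lia.
  by rewrite -sumrN; apply: eq_bigr => i _; rewrite scaleNr opprK.
rewrite scalerDr part1 part2 -zsD; try exact: zfinZ.
rewrite eg -[RHS](zs_lin ( *:%R (- n%:~R)) zg); apply: eq_zs => q /=.
rewrite -scalerDl -rmorphD -rmorphN /=; congr (_%:~R *: _); lia.
Qed.

Lemma kap2 : kap *+ 2 != 0.
Proof. by rewrite mulrn_eq0 /= kap0. Qed.

Lemma L_A c v : L (A (- c) v) = A (- c) (L v) + c%:~R *: A (- (c + 1)) v.
Proof.
rewrite /L NO_A_comm scalerDr AZ scalerA; congr (_ + _ *: _).
have -> : c%:~R * kap * (1 + 1) = c%:~R * (kap *+ 2) by rewrite mulr2n; ring.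
by rewrite mulrCA mulVf ?mulr1 ?kap2.
Qed.

Lemma L_vac b : L (mon [::] b) = b%:~R *: mon [:: 0%N] b.
Proof.
rewrite /L (NO_vac _ 1) big_ord_recl big_ord1 /nterm /= /bump /=.
rewrite !oppr0 !scale1r A0_mon AZ -(@A_mon 0 [::] b).
rewrite -scalerDl scalerA; congr (_ *: _).
have -> : kap * b%:~R + kap * b%:~R = b%:~R * (kap *+ 2) by rewrite mulr2n; ring.
by rewrite mulrCA mulVf ?mulr1 ?kap2.
Qed.

Lemma YDr n u v v' : Y n u (v + v') = Y n u v + Y n u v'.
Proof. exact: linearD. Qed.

(** The monomials are built by creation operators, on which L is a derivation. In the inductive step
    the two coefficients of the term c are -(c - j - 1 + n) and, by [bin_S], c - j - 1; they add up
    to -n. *)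
Lemma Y_L n u v : Y n (L u) v = - n%:~R *: Y (n - 1) u v.
Proof.
elim/mon_ind: u => [|c s b u IH]; first by rewrite raddf0 !Y0l scaler0.
rewrite (linearP L) /= 2!YDl 2!YZl IH scalerDr; congr (_ + _).
rewrite scalerA mulrC -scalerA; congr (_ *: _) => {u c IH}.
elim: s n v => [|j s IH] n v.
  rewrite (@L_vac) YZl !Y_mon /= -(@e_translation).
  congr (_ *: _).
  by apply: eq_NO => // c; rewrite bin0.
have jE : Negz j = - j.+1%:Z by lia.
have j1E : Negz j.+1 = - (j.+1%:Z + 1) by lia.
rewrite -(@A_mon) jE (@L_A) -j1E -jE YDl YZl !Y_X.
rewrite /NO -![_ *: zs _](zs_lin ( *:%R _)); try exact/zfinZ/zfin_nterm/field_Y.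
rewrite -zsD; first last.
- apply: (zfin_lin ( *:%R _)); exact/zfinZ/zfin_nterm/field_Y.
- exact/zfinZ/zfin_nterm/field_Y.
apply: eq_zs => c /=.
have -> : j.+2%:Z - n = j.+1%:Z - (n - 1) by lia.
set W := j.+1%:Z - (n - 1).
have -> : nterm (fun m => Y m (L (mon s b))) (j.+1%:Z - n) v c =
    - (c - (j.+1%:Z - n))%:~R *: nterm (fun m => Y m (mon s b)) W v c.
  have cW : c - W = c - (j.+1%:Z - n) - 1 by rewrite /W; lia.
  by rewrite /nterm cW; case: ifP => _; rewrite IH ?(@AZ).
rewrite !scalerA -scalerDl.
congr (_ *: _).
rewrite -[X in _ + X = _]/(j.+1%:R * bin j.+1 c) bin_S !mulrzBr.
ring.
Qed.

(** For n >= 0, nonpositive c annihilate the vacuum, [bin j] kills 0 < c <= j, and beyond that the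
    inner index is again nonnegative. The conditional form serves as a rewrite rule. *)
Lemma Mo_vac n s a : Mo s a n (mon [::] 0) =
  if 0 <= n then 0 else Mo s a n (mon [::] 0).
Proof.
case: ifP => // n0; elim: s n n0 => [|j s IH] n n0.
  apply: homog_neg (@homog_e a n _ _ _ (@homog_mon [::] 0)).
  by rewrite /wt /= /Defs.form; lia.
rewrite /= /NO -[RHS](@zs0 V); apply: eq_zs => c.
have [c0|c0] := ltrP 0 c; last first.
  rewrite nterm_npos //; have [->|cn] := eqVneq c 0.
    by rewrite oppr0 A0_mon mulr0z mulr0 scale0r raddf0 scaler0.
  by rewrite Apos_vac ?raddf0 ?scaler0 //; lia.
have [h|h] := lerP c j%:Z; first by rewrite bin_lt // scale0r.
by rewrite nterm_pos // IH ?raddf0 ?scaler0 //; lia.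
Qed.

Lemma Mo_vac_rec j s a n : n < 0 -> Mo (j :: s) a n (mon [::] 0) =
  \sum_(i < absz n) bin j (j.+1%:Z + i%:Z) *:
     A (- (j.+1%:Z + i%:Z)) (Mo s a (n + i%:Z) (mon [::] 0)).
Proof.
move=> n0; rewrite /= /NO (@zs_split _ _ j%:Z (absz n) 0) //; first last.
- move=> c hc c0; rewrite nterm_npos //; have [->|cn] := eqVneq c 0.
    by rewrite oppr0 A0_mon mulr0z mulr0 scale0r raddf0 scaler0.
  by rewrite Apos_vac ?raddf0 ?scaler0 //; lia.
- move=> c hc c0; rewrite nterm_pos // Mo_vac ifT ?raddf0 ?scaler0 //; lia.
- by move=> c /andP[c0 cj]; rewrite bin_lt // scale0r.
rewrite big_ord0 addr0; apply: eq_bigr => i _.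
have -> : j%:Z + 1 + i%:Z = j.+1%:Z + i%:Z by lia.
by rewrite nterm_pos //; congr (_ *: A _ (Mo _ _ _ _)); lia.
Qed.

Lemma e_vac a n : n < 0 -> e a n (mon [::] 0) = S a (- n - 1) (mon [::] a).
Proof.
move=> n0; rewrite (e_homog a n (@homog_mon [::] 0)) (zs1 (d := 0)).
  rewrite /eterm /T E0 sh_mon addr0; congr (S _ _ _).
  by rewrite /Defs.form; lia.
move=> q q0; rewrite /eterm; suff -> : T a q (sh a (mon [::] 0)) = 0.
  exact: raddf0.
have [qn|qn] := ltrP q 0; first by rewrite /T E_neg.
by apply: (@T_trunc a q _ _ _ (homog_sh a (@homog_mon [::] 0))); rewrite /wt /=; lia.
Qed.

Lemma creation s a : Mo s a (-1) (mon [::] 0) = mon s a.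
Proof.
elim: s => [|j s IH]; first by rewrite /= e_vac.
rewrite Mo_vac_rec // big_ord1 addr0 addr0 bin_diag scale1r IH.
have -> : - j.+1%:Z = Negz j by [].
exact: A_mon.
Qed.

Lemma S1 a v : S a 1 v = a%:~R *: A (-1) v.
Proof.
have := @E_rec a%:~R (-1) 1 v 1 isT.
by rewrite big_ord1 subrr E0 scale1r.
Qed.

(** With the vacuum as right factor this puts L(-1) V_L^+ into C_2. Only two terms of [Mo_vac_rec]
    occur, and they are the two terms of [L_A]. *)
Lemma Y_vac u : Y (-2) u (mon [::] 0) = L u.
Proof.
elim/mon_ind: u => [|c s b u IH]; first by rewrite Y0l raddf0.
rewrite (linearP L) /= YDl YZl IH Y_mon; congr (_ *: _ + _) => {u c IH}.
elim: s => [|j s IH].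
  by rewrite /= e_vac // (@L_vac) -[_ - 1]/(1 : int) S1 -(@A_mon).
rewrite Mo_vac_rec // !big_ord_recl big_ord0 addr0 /= /bump /= !addr0.
rewrite bin_diag scale1r IH creation.
have jE : Negz j = - j.+1%:Z by lia.
rewrite -(@A_mon) jE (@L_A); congr (_ + _).
have -> : j.+1%:Z + (1 + 0)%N = j.+2%:Z by lia.
by rewrite bin_diagS.
Qed.

(** * Vectors whose theta-symmetrization lies in C_2 *)

Definition Ct (v : V) : Prop := C2 (v + theta v).

Lemma Ct_0 : Ct 0.
Proof. by rewrite /Ct raddf0 addr0; apply: C2_0. Qed.

Lemma Ct_lin c x y : Ct x -> Ct y -> Ct (c *: x + y).
Proof.
rewrite /Ct linearP /= addrACA -scalerDr => hx hy.
exact/C2_D/hy/C2_Z.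
Qed.

Lemma Ct_D x y : Ct x -> Ct y -> Ct (x + y).
Proof. by move=> hx hy; rewrite -[x]scale1r; apply: Ct_lin. Qed.

Lemma Ct_Z c x : Ct x -> Ct (c *: x).
Proof. by move=> hx; rewrite -[_ *: _]addr0; apply: Ct_lin => //; apply: Ct_0. Qed.

(** By [Y_L], u_(n-1) is a nonzero multiple of (L u)_n, and L u is again fixed by theta, so
    everything comes down to n = -2. *)
Lemma C2_Y n u v : n <= -2 -> theta u = u -> theta v = v -> C2 (Y n u v).
Proof.
move=> n2; have -> : n = - ((absz n - 2)%N%:Z) - 2 by lia.
elim: (absz n - 2)%N u => [|m IH] u hu hv.
  by rewrite -[Y _ _ _]addr0; apply: C2_S => //; apply: C2_0.
set n' := - m%:Z - 2.
have -> : - m.+1%:Z - 2 = n' - 1 by rewrite /n'; lia.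
have n0 : - n'%:~R != 0 :> F by rewrite -mulrNz intr_eq0 /n'; lia.
have -> : Y (n' - 1) u v = (- n'%:~R)^-1 *: Y n' (L u) v.
  by rewrite Y_L scalerA mulVf // scale1r.
by apply/C2_Z/IH => //; rewrite theta_L hu.
Qed.

(** Only u has to be fixed: symmetrizing u_n v gives u_n (v + theta v). *)
Lemma Ct_Y n u v : n <= -2 -> theta u = u -> Ct (Y n u v).
Proof.
move=> n2 hu; rewrite /Ct theta_Y hu -YDr; apply: C2_Y => //.
by rewrite raddfD /= thetaK addrC.
Qed.

Lemma Ct_L v : Ct (L v).
Proof.
rewrite /Ct theta_L -[L v + _]linearD /= -Y_vac; apply: C2_Y => //.
  by rewrite raddfD /= thetaK addrC.
by rewrite theta_mon scale1r oppr0.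
Qed.

Lemma C2_of_Ct : (forall v, Ct v) -> forall v, theta v = v -> C2 v.
Proof.
move=> h v hv; have E : 2%:R^-1 *: (v + theta v) = v.
  by rewrite hv -mulr2n -scaler_nat scalerA mulVf ?scale1r // pnatr_eq0.
by rewrite -E; apply/C2_Z/h.
Qed.

(** * Quadratic operators and the reduction of V[b] *)

(** The coefficients are arbitrary polynomials in c, rather than binomials, so that commutators stay
    in the class. *)
Definition Q (p : {poly F}) (W : int) (v : V) : V :=
  NO (fun c => p.[c%:~R]) A W v.
HB.instance Definition _ p W :=
  GRing.isLinear.Build F V V _ (Q p W) (NO_lin (field_A) _ W).

Lemma QD p W x y : Q p W (x + y) = Q p W x + Q p W y.
Proof. exact: linearD. Qed.
Lemma QZ p W c x : Q p W (c *: x) = c *: Q p W x.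
Proof. exact: linearZ. Qed.

Lemma QDp p q W v : Q (p + q) W v = Q p W v + Q q W v.
Proof.
rewrite /Q -(NO_addP field_A); apply: eq_NO => // c.
by rewrite hornerD.
Qed.

Lemma QZp a p W v : Q (a *: p) W v = a *: Q p W v.
Proof.
rewrite /Q -(NO_scaleP field_A); apply: eq_NO => // c.
by rewrite hornerZ.
Qed.

Definition Rp (p : {poly F}) (W : int) (x : F) : F :=
  x * kap * (p.[W%:~R + x] + p.[- x]).

Lemma Q_A p W c v : Q p W (A (- c) v) =
  A (- c) (Q p W v) + Rp p W c%:~R *: A (- (c + W)) v.
Proof. by rewrite /Q NO_A_comm rmorphD rmorphN. Qed.

Lemma homog_Q p W d b v : homog d b v -> homog (d + W) b (Q p W v).
Proof.
move=> hv; have := @homog_NO A (fun c => p.[c%:~R]) d b 0 b W v.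
rewrite addr0; apply=> // n d0 x hx; rewrite addr0; exact: homog_A.
Qed.

Lemma vcoord_A p M b v : vcoord (M, b) (A p.+1%:Z v) =
  p.+1%:R * kap * (M p).+1%:R * vcoord ((p +` M)%mset, b) v.
Proof.
elim/VL_ind: v => [|c [M' b'] v IH]; first by rewrite !raddf0 mulr0.
rewrite !linearP /= IH mulrDr; congr (_ + _).
rewrite mulrCA; congr (_ * _) => {IH v c}; rewrite AU /= linearZ /=.
rewrite !vcoordU !xpair_eqE.
case: (posnP (M' p)) => [M0|Mp].
  rewrite M0 mulr0 mul0r; have -> : (M' == p +` M)%mset = false.
    by apply/eqP => h; move: M0; rewrite h mset1DE eqxx.
  by rewrite mulr0.
have -> : (M' `\ p == M)%mset = (M' == p +` M)%mset.
  apply/eqP/eqP => [<-|->]; last by rewrite msetD1K.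
  by rewrite msetB1K -?mset_gt0.
case: eqP => [->|_]; last by rewrite !mulr0.
by rewrite mset1DE eqxx.
Qed.

(** In positive weight every monomial has a factor, and the annihilation operator of that factor
    detects its coefficient up to a multiple that is nonzero since [kap] is. *)
Lemma singular_eq0 d b v : 0 < d -> homog d b v ->
  (forall p, 0 < p -> A p v = 0) -> v = 0.
Proof.
move=> d0 hv hA; apply: vcoord_inj => -[M b']; rewrite raddf0.
have [//|ne] := eqVneq (vcoord (M, b') v) 0.
have [/= wM _] := hv _ ne.
case E : (mseq M) => [|p s].
  by move: wM; rewrite -[M]mseqK wtm_seq E /wt /=; lia.
have Mp : (0 < M p)%N.
  have -> : M p = count_mem p (mseq M) by rewrite -mset_seqE mseqK.
  by rewrite E /= eqxx.
have /(congr1 (vcoord ((M `\ p)%mset, b'))) := hA p.+1%:Z isT.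
rewrite vcoord_A raddf0 msetB1K -?mset_gt0 // => /eqP.
by rewrite !mulf_eq0 !pnatr_eq0 (negbTE (@kap0)) /= => /eqP.
Qed.

(** Z e^b is killed by all A_p with p > 0, hence is 0, and creation operators carry this to all
    monomials. An identity of operators thus reduces to its brackets with the A_(-c). *)
Lemma A_commutant (Z : {linear V -> V}) d : 0 < d ->
  (forall c v, Z (A (- c) v) = A (- c) (Z v)) ->
  (forall b, homog d b (Z (mon [::] b))) -> forall v, Z v = 0.
Proof.
move=> d0 ZA Zh; have Z0 b : Z (mon [::] b) = 0.
  apply: singular_eq0 d0 (Zh b) _ => p p0.
  by rewrite -[p]opprK -ZA opprK Apos_vac ?raddf0.
elim/mon_ind => [|c s b x IH]; first exact: raddf0.
rewrite linearP IH addr0 (_ : Z (mon s b) = 0) ?scaler0 //.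
elim: s => [//|j s IHs]; rewrite -(@A_mon).
have -> : Negz j = - j.+1%:Z by lia.
by rewrite ZA IHs raddf0.
Qed.

Lemma Rp_comm p p' p'' W W' x :
  (forall x, p''.[x] = p'.[x - W%:~R] * Rp p W (x - W%:~R) +
                       p'.[x] * Rp p W (W'%:~R - x)) ->
  Rp p'' (W + W') x =
    Rp p' W' x * Rp p W (x + W'%:~R) - Rp p W x * Rp p' W' (x + W%:~R).
Proof.
move=> hp; rewrite /Rp !hp /Rp !rmorphD /=.
move: (W%:~R) (W'%:~R) => w w'.
(* Values of p and p' are atoms for [ring], so their arguments are first made syntactically
   equal. *)
have -> : w + w' + x - w = w' + x by ring.
have -> : w + (w' + x) = w + (x + w') by ring.
have -> : - (w' + x) = - (x + w') by ring.
have -> : w' - (w + w' + x) = - (x + w) by ring.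
have -> : w + - (x + w) = - x by ring.
have -> : - - (x + w) = w + x by ring.
have -> : - x - w = - (x + w) by ring.
have -> : w + - (x + w) = - x by ring.
have -> : - - (x + w) = w + x by ring.
have -> : w' - - x = x + w' by ring.
have -> : w + w' + x = w' + (x + w) by ring.
ring.
Qed.

(** Both sides have the same brackets with every A_(-c) by [Rp_comm], so [A_commutant] applies. The
    condition on W + W' excludes the central term. *)
Lemma Q_comm p W p' W' p'' v : 0 < W + W' ->
  (forall x, p''.[x] = p'.[x - W%:~R] * Rp p W (x - W%:~R) +
                       p'.[x] * Rp p W (W'%:~R - x)) ->
  Q p W (Q p' W' v) = Q p' W' (Q p W v) + Q p'' (W + W') v.
Proof.
move=> W0 hp; apply/eqP; rewrite -subr_eq0 opprD addrA; apply/eqP.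
pose Z x := Q p W (Q p' W' x) - Q p' W' (Q p W x) - Q p'' (W + W') x.
have Zl : linear Z by move=> a x y; rewrite /Z !(QD, QZ); lmod; ring.
pose ZL : {linear V -> V} := HB.pack Z (GRing.isLinear.Build F V V _ Z Zl).
apply: (A_commutant (Z := ZL) W0) => [c x|b]; rewrite /= /Z.
  rewrite !Q_A !QD !QZ !Q_A !AD !(linearN (A (- c))) /=.
  rewrite (Rp_comm _ hp) !rmorphD /=.
  have -> : - (c + W' + W) = - (c + (W + W')) by lia.
  have -> : - (c + W + W') = - (c + (W + W')) by lia.
  lmod; ring.
have h := @homog_mon [::] b.
rewrite [X in homog X _ _](_ : _ = (wt [::])%:Z + W' + W); last by rewrite /wt /=; lia.
apply: homogD; first apply: homogD.
- exact/homog_Q/homog_Q.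
- rewrite -scaleN1r; apply: homogZ; rewrite addrAC; exact/homog_Q/homog_Q.
- rewrite -scaleN1r; apply: homogZ; rewrite -addrA [X in _ + X]addrC; exact: homog_Q.
Qed.

Fixpoint binp (j : nat) : {poly F} :=
  if j is j'.+1 then (j%:R)^-1 *: (binp j' * ('X - j%:R%:P)) else 1.

Lemma binpE j c : (binp j).[c%:~R] = bin j c.
Proof.
elim: j => [|j IH]; first by rewrite /= hornerC bin0.
rewrite hornerZ hornerM hornerXsubC IH.
have -> : bin j.+1 c = (j.+1%:R)^-1 * (j.+1%:R * bin j.+1 c).
  by rewrite mulrA mulVf ?mul1r // pnatr_eq0.
by rewrite bin_S mulrzBr [_ * bin j c]mulrC.
Qed.

Lemma size_binp j : size (binp j) = j.+1.
Proof.
elim: j => [|j IH]; first by rewrite size_poly1.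
rewrite size_scale ?invr_eq0 ?pnatr_eq0 // size_Mmonic ?monicXsubC //.
  by rewrite IH size_XsubC addn2.
by rewrite -size_poly_eq0 IH.
Qed.

Lemma binp_span (P : {poly F} -> Prop) d : P 0 ->
  (forall a p q, P p -> P q -> P (a *: p + q)) ->
  (forall j, (j < d)%N -> P (binp j)) -> forall p : {poly F}, (size p <= d)%N -> P p.
Proof.
move=> P0 PD; elim: d => [|d IH] Pb p.
  by rewrite leqn0 size_poly_eq0 => /eqP->.
move=> sp; pose a := p`_d / (binp d)`_d.
have lb : (binp d)`_d != 0.
  have := lead_coef_eq0 (binp d); rewrite /lead_coef size_binp /= => ->.
  by rewrite -size_poly_eq0 size_binp.
rewrite -(subrK (a *: binp d) p) addrC; apply: PD; first exact: Pb.
apply: IH => [j jd|]; first by apply: Pb; rewrite ltnS ltnW.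
apply/leq_sizeP => i; rewrite leq_eqVlt coefB coefZ => /orP[/eqP<-|di].
  by rewrite /a divfK ?subrr.
rewrite !nth_default ?mulr0 ?subrr ?size_binp //.
exact: leq_trans sp di.
Qed.

Lemma size_comp_affine (p q : {poly F}) : (size q <= 2)%N ->
  (size (p \Po q) <= size p)%N.
Proof.
have [->|p0] := eqVneq p 0; first by rewrite comp_poly0.
move=> sq; apply: leq_trans (size_comp_poly_leq _ _) _.
have : (0 < size p)%N by rewrite size_poly_gt0.
case: (size p) => // n _; rewrite ltnS /=.
by case: (size q) sq => [|[|[|]]] //= _; rewrite ?muln0 ?muln1.
Qed.

Lemma LE v : L v = (kap *+ 2)^-1 *: Q 1 1 v.
Proof. by congr (_ *: _); apply: eq_NO => // c; rewrite hornerC. Qed.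

Lemma Mo0_A m x : Mo [:: 0%N] 0 m x = A m x.
Proof.
rewrite /= /NO (zs1 (d := - m)) => [|c cm].
  rewrite bin0 scale1r; have [h|h] := ltrP 0 (- m).
    by rewrite nterm_pos // opprK e0 ifT //; apply/eqP; lia.
  by rewrite nterm_npos // opprK e0 ifT //; apply/eqP; lia.
have h : c - (1%:Z - m) == -1 = false by apply/eqP; move/eqP: cm; lia.
by rewrite bin0 scale1r /nterm !e0 h raddf0 if_same.
Qed.

(** The mode index is at most -2 exactly when W >= size (binp j) + 2, the bound that defines
    [DD]. *)
Lemma Q_Y j W y : Q (binp j) W y = Y (j.+1%:Z - W) (mon [:: j; 0%N] 0) y.
Proof.
transitivity (NO (bin j) (Mo [:: 0%N] 0) (j.+1%:Z - (j.+1%:Z - W)) y); last first.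
  by rewrite Y_mon.
rewrite subKr; apply: eq_NO => [c|m x]; first exact: binpE.
by rewrite Mo0_A.
Qed.

(* The span of the vectors u_(-n) y (n >= 2, u quadratic) and L(-1) y. *)
Inductive DD : V -> Prop :=
| DD_0 : DD 0
| DD_Q (p : {poly F}) (W : nat) y x : (size p + 2 <= W)%N -> DD x -> DD (Q p W%:Z y + x)
| DD_L y x : DD x -> DD (L y + x).

Lemma DD_D x y : DD x -> DD y -> DD (x + y).
Proof.
move=> hx hy; elim: hx => [|p W z x' h _ IH|z x' _ IH].
- by rewrite add0r.
- by rewrite -addrA; apply: DD_Q.
- by rewrite -addrA; apply: DD_L.
Qed.

Lemma DD_Z c x : DD x -> DD (c *: x).
Proof.
elim => [|p W z x' h _ IH|z x' _ IH].
- by rewrite scaler0; apply: DD_0.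
- by rewrite scalerDr -(QZ p W%:Z); apply: DD_Q.
- by rewrite scalerDr -linearZ; apply: DD_L.
Qed.

Lemma DD_B x y : DD x -> DD y -> DD (x - y).
Proof. by move=> hx hy; apply: DD_D => //; rewrite -scaleN1r; apply: DD_Z. Qed.

Lemma DD_Q1 (p : {poly F}) (W : nat) y : (size p + 2 <= W)%N -> DD (Q p W%:Z y).
Proof. by move=> h; rewrite -[Q _ _ _]addr0; apply: DD_Q => //; apply: DD_0. Qed.

Lemma DD_L1 y : DD (L y).
Proof. by rewrite -[L _]addr0; apply: DD_L; apply: DD_0. Qed.

(** The coefficients of [Q p W, Q p' W'], with [R] the polynomial form of [Rp]: one summand moves
    the first Heisenberg factor of Q p' W', the other moves the second. *)
Definition commp (p : {poly F}) (W : int) (p' : {poly F}) (W' : int) : {poly F} :=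
  let R := kap *: ('X * ((p \Po (W%:~R%:P + 'X)) + (p \Po (- 'X)))) in
  (p' \Po ('X - W%:~R%:P)) * (R \Po ('X - W%:~R%:P)) + p' * (R \Po (W'%:~R%:P - 'X)).

Lemma commpE p W p' W' x : (commp p W p' W').[x] =
  p'.[x - W%:~R] * Rp p W (x - W%:~R) + p'.[x] * Rp p W (W'%:~R - x).
Proof.
rewrite /commp /Rp !(hornerE, horner_comp) /=.
ring.
Qed.

Lemma size_commp (p : {poly F}) W p' W' :
  (size (commp p W p' W') <= size p' + size p)%N.
Proof.
rewrite /commp; set R := kap *: _.
have sX : (size ('X - W%:~R%:P : {poly F})%R <= 2)%N by rewrite size_XsubC.
have sX' : (size (W'%:~R%:P - 'X : {poly F})%R <= 2)%N.
  by rewrite -opprB size_polyN size_XsubC.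
have sX2 : (size (W%:~R%:P + 'X : {poly F})%R <= 2)%N by rewrite addrC size_XaddC.
have sX3 : (size (- 'X : {poly F})%R <= 2)%N by rewrite size_polyN size_polyX.
have sR : (size R <= (size p).+1)%N.
  apply: leq_trans (size_scale_leq _ _) _; apply: leq_trans (size_polyMleq _ _) _.
  rewrite size_polyX /= ltnS; apply: leq_trans (size_polyD _ _) _.
  by rewrite geq_max !size_comp_affine.
apply: leq_trans (size_polyD _ _) _; rewrite geq_max.
have h (q r : {poly F}) : (size q <= size p')%N -> (size r <= (size p).+1)%N ->
    (size (q * r)%R <= size p' + size p)%N.
  move=> hq hr; apply: leq_trans (size_polyMleq _ _) _; lia.
apply/andP; split; apply: h => //; first exact: size_comp_affine.
- exact: leq_trans (size_comp_affine _ sX) sR.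
- exact: leq_trans (size_comp_affine _ sX') sR.
Qed.

Lemma Ct_DD x : DD x -> Ct x.
Proof.
elim => [|p W y x' h _ IH|y x' _ IH]; first exact: Ct_0.
  apply: Ct_D IH => {x'}.
  apply: (@binp_span (fun p => Ct (Q p W%:Z y)) (W - 2)) => [||j hj|].
  - have -> : Q 0 W%:Z y = 0 *: Q 0 W%:Z y by rewrite -QZp scale0r.
    by rewrite scale0r; apply: Ct_0.
  - by move=> a p1 q1 h1 h2; rewrite QDp QZp; apply: Ct_lin.
  - rewrite Q_Y; apply: Ct_Y => //; first by lia.
    by rewrite theta_mon oppr0 /= expr2 mulrNN mulr1 scale1r.
  - by lia.
by apply: Ct_D IH; apply: Ct_L.
Qed.

(** Sizes and weights both add under commutators ([size_commp]), so the excess W' - size p' >= 2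
    survives. L has excess 0; there a cancellation in the commutator has to help, which is the last
    condition on p. *)
Lemma DD_stable (p : {poly F}) (W : nat) : (0 < W)%N -> (size p <= W)%N ->
  (size (commp p W%:Z 1 1) < W)%N ->
  forall x, DD x -> DD (Q p W%:Z x).
Proof.
move=> W0 sp sc x; elim => [|p' W' y x' h _ IH|y x' _ IH].
- by rewrite raddf0; apply: DD_0.
- rewrite QD; apply: DD_D IH; rewrite (@Q_comm _ _ _ _ (commp p W%:Z p' W'%:Z)).
  + apply: DD_D; apply: DD_Q1 => //.
    by have := size_commp p W%:Z p' W'%:Z; lia.
  + by lia.
  + by move=> z; rewrite commpE.
- rewrite QD; apply: DD_D IH; rewrite LE QZ.
  rewrite (@Q_comm _ _ _ _ (commp p W%:Z 1 1)); first last.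
  + by move=> z; rewrite commpE.
  + by lia.
  rewrite scalerDr -LE; apply: DD_D; first exact: DD_L1.
  apply: DD_Z; have -> : W%:Z + 1 = W.+1%:Z by lia.
  by apply: DD_Q1; lia.
Qed.

(** By [Q_Y], [Om] and [U] are the modes of index -1 of x_1 x_1 and x_3 x_1, just outside the range
    of [DD]. *)
Definition Om : V -> V := Q 1 2.
Definition U : V -> V := Q (binp 2) 4.
HB.instance Definition _ := GRing.Linear.on Om.
HB.instance Definition _ := GRing.Linear.on U.

Lemma OmB x y : Om (x - y) = Om x - Om y. Proof. exact: linearB. Qed.
Lemma OmD x y : Om (x + y) = Om x + Om y. Proof. exact: linearD. Qed.
Lemma OmZ c x : Om (c *: x) = c *: Om x. Proof. exact: linearZ. Qed.
Lemma UD x y : U (x + y) = U x + U y. Proof. exact: linearD. Qed.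
Lemma UZ c x : U (c *: x) = c *: U x. Proof. exact: linearZ. Qed.

Lemma size_Poly3 (a b c : F) : (size (a%:P + b%:P * 'X + c%:P * 'X^2)%R <= 3)%N.
Proof.
have -> : a%:P + b%:P * 'X + c%:P * 'X^2 = Poly [:: a; b; c].
  by rewrite /= !cons_poly_def mul0r add0r; ring.
exact: size_Poly.
Qed.

Lemma commp_Om : (size (commp 1 2 1 1) < 2)%N.
Proof.
have -> : commp 1 2 1 1 = (- (kap *+ 2))%:P.
  rewrite /commp -mul_polyC !comp_polyM !comp_polyC ?comp_polyX !rmorph1.
  rewrite !comp_polyD !comp_polyC polyCN polyCMn; ring.
exact: size_polyC_leq1.
Qed.

Lemma binp2E : binp 2 = (2%:R^-1)%:P * (('X - 1%:P) * ('X - 2%:R%:P)).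
Proof. by rewrite /= invr1 scale1r mul1r mul_polyC. Qed.

(** The general bound still allows degree 3; the cubic terms cancel. *)
Lemma commp_U : (size (commp (binp 2) 4 1 1) < 4)%N.
Proof.
have h2 : (2%:R^-1)%:P * 2%:R = 1 :> {poly F}.
  by rewrite -polyC_natr -polyCM mulVf // pnatr_eq0.
have -> : commp (binp 2) 4 1 1 =
    (- kap * 7%:R)%:P + (kap * 5%:R)%:P * 'X + (- kap)%:P * 'X^2.
  rewrite /commp binp2E -!mul_polyC !rmorph1.
  rewrite !(comp_polyM, comp_polyC, comp_polyB, comp_polyX, comp_polyD, rmorph1).
  rewrite !(raddfN (comp_poly _)) /= !comp_polyX !polyCM !polyCN !polyC_natr.
  (* [ring] cannot divide here, so the right side is multiplied by 1 written as (1/2) 2. *)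
  rewrite -[RHS]mul1r -[X in _ = X * _]h2; ring.
exact: size_Poly3.
Qed.

Lemma DD_Om x : DD x -> DD (Om x).
Proof. by apply: (DD_stable (W := 2)); rewrite ?size_poly1 ?commp_Om. Qed.

Lemma DD_U x : DD x -> DD (U x).
Proof. by apply: (DD_stable (W := 4)); rewrite ?size_binp ?commp_U. Qed.

Lemma DD_UOm x : DD (U (Om x) - Om (U x)).
Proof.
rewrite /U /Om (@Q_comm _ _ _ _ (commp (binp 2) 4 1 2)) //; last first.
  by move=> z; rewrite commpE.
rewrite addrC addKr; apply: (@DD_Q1 _ 6).
by have := size_commp (binp 2) 4 1 2; rewrite size_poly1 size_binp; lia.
Qed.

(* The span of the monomials in V[b] of weight N with at most d Heisenberg factors. *)
Inductive Sp (d N : nat) (b : int) : V -> Prop :=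
| Sp_0 : Sp d N b 0
| Sp_S c s x : (size s <= d)%N -> wt s = N -> Sp d N b x ->
    Sp d N b (c *: mon s b + x).

Lemma Sp_D d N b x y : Sp d N b x -> Sp d N b y -> Sp d N b (x + y).
Proof.
move=> hx hy; elim: hx => [|c s z h1 h2 _ IH]; first by rewrite add0r.
by rewrite -addrA; apply: Sp_S.
Qed.

Lemma Sp_Z d N b a x : Sp d N b x -> Sp d N b (a *: x).
Proof.
elim => [|c s z h1 h2 _ IH]; first by rewrite scaler0; apply: Sp_0.
by rewrite scalerDr scalerA; apply: Sp_S.
Qed.

Lemma Sp_mon d N b s : (size s <= d)%N -> wt s = N -> Sp d N b (mon s b).
Proof.
move=> h1 h2; rewrite -[mon s b]scale1r -[_ *: _]addr0.
by apply: Sp_S => //; apply: Sp_0.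
Qed.

Lemma Sp_A d N b j x : Sp d N b x -> Sp d.+1 (N + j.+1) b (A (Negz j) x).
Proof.
elim => [|c s z h1 h2 _ IH]; first by rewrite raddf0; apply: Sp_0.
rewrite linearP /= A_mon; apply: Sp_S => //.
by rewrite -h2 /wt /=; lia.
Qed.

Lemma mon_perm s t b : perm_eq s t -> mon s b = mon t b.
Proof. by move=> /eq_seq_msetP st; rewrite /mon st. Qed.

Lemma wt_cons j s : wt (j :: s) = (wt s + j.+1)%N.
Proof. by rewrite /wt /=; lia. Qed.

Lemma L_cons j s b : L (mon (j :: s) b) =
  A (Negz j) (L (mon s b)) + j.+1%:R *: mon (j.+1 :: s) b.
Proof.
have j1E : Negz j.+1 = - (j.+1%:Z + 1) by lia.
rewrite -!(@A_mon); have -> : Negz j = - j.+1%:Z by lia.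
by rewrite (@L_A) -j1E.
Qed.

Lemma L_lead s b :
  Sp (size s) (wt s).+1 b (L (mon s b) - b%:~R *: mon (0%N :: s) b).
Proof.
elim: s => [|j s IH]; first by rewrite (@L_vac) subrr; apply: Sp_0.
rewrite L_cons (@mon_perm [:: 0, j & s]%N [:: j, 0 & s]%N); last first.
  by rewrite (perm_catCA [:: 0%N] [:: j]).
rewrite -(@A_mon j (0%N :: s)) addrAC -AZ -linearB /=.
rewrite addrC; apply: Sp_S => //.
rewrite wt_cons -addSn; exact: Sp_A.
Qed.

Lemma nterm_mid (m : nat) (i : nat) s b : (i <= m)%N ->
  nterm A m.+2%:Z (mon s b) i.+1%:Z = mon [:: i, (m - i)%N & s] b.
Proof.
move=> im; rewrite nterm_pos //.
have -> : i.+1%:Z - m.+2%:Z = Negz (m - i) by lia.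
by rewrite !A_mon.
Qed.

Lemma Q_vac p (m : nat) b : Q p m.+2%:Z (mon [::] b) =
  \sum_(i < m.+1) p.[i.+1%:R] *: mon [:: val i; (m - i)%N] b +
  ((p.[0] + p.[m.+2%:R]) * kap * b%:~R) *: mon [:: m.+1] b.
Proof.
rewrite /Q NO_vac big_ord_recl big_ord_recr /= /bump /= add1n.
rewrite addrCA; congr (_ + _).
  by apply: eq_bigr => i _; rewrite add1n nterm_mid // -ltnS.
rewrite nterm_npos // nterm_pos // subrr oppr0 A0_mon sub0r AZ.
have -> : - m.+2%:Z = Negz m.+1 by lia.
rewrite linearZ /= A_mon !scalerA -scalerDl; congr (_ *: _).
by rewrite mulr0z; ring.
Qed.

(** The subtracted terms add two factors to s. A zero mode adds only one, and a contraction with s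
    replaces one. *)
Lemma Q_lead p (m : nat) s b : Sp (size s).+1 (wt s + m.+2) b
  (Q p m.+2%:Z (mon s b) -
   \sum_(i < m.+1) p.[i.+1%:R] *: mon [:: val i, (m - i)%N & s] b).
Proof.
elim: s => [|j s IH].
  rewrite Q_vac addrC addKr; apply: Sp_Z; apply: Sp_mon => //.
  by rewrite /wt /=; lia.
rewrite -(@A_mon j s); have jE : Negz j = - j.+1%:Z by lia.
rewrite {1}jE Q_A -jE.
have -> : \sum_(i < m.+1) p.[i.+1%:R] *: mon [:: val i, (m - i)%N, j & s] b =
  A (Negz j) (\sum_(i < m.+1) p.[i.+1%:R] *: mon [:: val i, (m - i)%N & s] b).
  rewrite raddf_sum; apply: eq_bigr => i _ /=; rewrite AZ A_mon.
  congr (_ *: _); apply: mon_perm.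
  by rewrite (perm_catCA [:: val i; (m - i)%N] [:: j]).
rewrite addrAC -linearB /= addrC.
have -> : - (j.+1%:Z + m.+2%:Z) = Negz (j + m.+2) by lia.
rewrite A_mon; apply: Sp_S => //; first by rewrite !wt_cons; lia.
by rewrite wt_cons addnAC; apply: Sp_A.
Qed.

(* Equality with an element of [Sp d N b] modulo [DD]. *)
Definition LD d N b x := exists2 y, DD (x - y) & Sp d N b y.

Lemma LD_D d N b x y : LD d N b x -> LD d N b y -> LD d N b (x + y).
Proof.
move=> [x' h1 h2] [y' h3 h4]; exists (x' + y'); last exact: Sp_D.
by rewrite opprD addrACA; apply: DD_D.
Qed.

Lemma LD_Z d N b a x : LD d N b x -> LD d N b (a *: x).
Proof.
move=> [x' h1 h2]; exists (a *: x'); last exact: Sp_Z.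
by rewrite -scalerBr; apply: DD_Z.
Qed.

Lemma LD_B d N b x y : LD d N b x -> LD d N b y -> LD d N b (x - y).
Proof. by move=> hx hy; apply: LD_D => //; rewrite -scaleN1r; apply: LD_Z. Qed.

Lemma LD_Sp d N b x : Sp d N b x -> LD d N b x.
Proof. by move=> h; exists x => //; rewrite subrr; apply: DD_0. Qed.

Lemma LD_DD d N b x : DD x -> LD d N b x.
Proof. by move=> h; exists 0; [rewrite subr0 | apply: Sp_0]. Qed.

Lemma LD_sum d N b (I : finType) (P : pred I) (f : I -> V) :
  (forall i, P i -> LD d N b (f i)) -> LD d N b (\sum_(i | P i) f i).
Proof.
move=> hf; elim/big_ind: _ => //; last exact: LD_D.
by apply/LD_Sp/Sp_0.
Qed.

(* Downward induction on the index: x_c x_(m+2-c) f is the leading term, among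
   those not yet reduced, of a mode of x_c x_1 that maps into [DD]; the last
   one, x_(m+1) x_1 f, is reduced by L(-1). *)
Lemma LD_pair b m c s : b != 0 -> (c <= m)%N ->
  LD (size s).+1 (wt s + m.+2) b (mon [:: c, (m - c)%N & s] b).
Proof.
move=> b0; have bF : b%:~R != 0 :> F by rewrite intr_eq0.
have [n] := ubnP (m - c); elim: n c => // n IH c hn cm.
have [ec|nc] := eqVneq c m.
  rewrite {}ec subnn (@mon_perm [:: m, 0 & s]%N [:: 0, m & s]%N); last first.
    by rewrite (perm_catCA [:: m] [:: 0%N]).
  have -> : mon [:: 0, m & s]%N b = (b%:~R)^-1 *: (L (mon (m :: s) b) -
     (L (mon (m :: s) b) - b%:~R *: mon [:: 0, m & s]%N b)).
    by rewrite subKr scalerA mulVf // scale1r.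
  apply/LD_Z/LD_B; first exact/LD_DD/DD_L1.
  have := L_lead (m :: s) b; rewrite wt_cons -addnS; exact: LD_Sp.
have lt_cm : (c < m)%N by rewrite ltn_neqAle nc cm.
have hQ : DD (Q (binp c) m.+2%:Z (mon s b)).
  by apply: DD_Q1; rewrite size_binp; lia.
have := Q_lead (binp c) m s b; set S := \sum_(_ < _) _ => hS.
have hSL : LD (size s).+1 (wt s + m.+2) b S.
  by rewrite -(subKr (Q (binp c) m.+2%:Z (mon s b)) S);
     apply: LD_B; [apply: LD_DD | apply: LD_Sp].
have cm1 : (c < m.+1)%N by [].
have SE : S = mon [:: c, (m - c)%N & s] b + \sum_(i < m.+1 | i != Ordinal cm1)
    bin c i.+1%:Z *: mon [:: val i, (m - i)%N & s] b.
  rewrite /S (bigD1 (Ordinal cm1)) //=; congr (_ + _).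
    by rewrite -[c.+1%:R]/((c.+1%:Z)%:~R) binpE bin_diag scale1r.
  by apply: eq_bigr => i _; rewrite -[i.+1%:R]/((i.+1%:Z)%:~R) binpE.
have -> : mon [:: c, (m - c)%N & s] b = S - \sum_(i < m.+1 | i != Ordinal cm1)
    bin c i.+1%:Z *: mon [:: val i, (m - i)%N & s] b by rewrite SE addrK.
apply: LD_B => //; apply: LD_sum => i ni.
(* [bin c] vanishes at 1, ..., c, so only indices above c remain for the induction. *)
have [ic|ci] := ltnP i c.
  by rewrite bin_lt ?scale0r //; apply: LD_Sp; apply: Sp_0.
apply: LD_Z; apply: IH; last exact: (ltn_ord i).
have : c != i by apply: contraNneq ni => e; apply/eqP/val_inj.
by have := ltn_ord i; move=> /= h1 h2; lia.
Qed.

Lemma LD_red d N b x : b != 0 -> LD d.+1 N b x -> LD 1 N b x.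
Proof.
move=> b0; elim: d x => // d IH x [y hxy hy]; apply: IH.
rewrite -(subrK y x); apply: LD_D; first exact: LD_DD.
elim: hy => [|c s z hs <- _ IH]; first exact/LD_Sp/Sp_0.
apply: LD_D IH; apply: LD_Z; case: (ltnP (size s) d.+2) => [h|h].
  by apply/LD_Sp/Sp_mon.
case: s hs h => [|i [|j t]] //= hs h.
have -> : d.+1 = (size t).+1 by lia.
have -> : wt [:: i, j & t] = (wt t + (i + j).+2)%N by rewrite !wt_cons; lia.
by have := @LD_pair b (i + j) i t b0 (leq_addr _ _); rewrite addKn.
Qed.

(** The only monomial of weight N in V[b] with at most one factor, so it spans what is left of that
    weight modulo [DD]. *)
Definition xN (N : nat) (b : int) : V := mon (if N is n.+1 then [:: n] else [::]) b.

Lemma homog_xN N b : homog N%:Z b (xN N b).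
Proof.
case: N => [|n]; first exact: (@homog_mon [::] b).
by have := @homog_mon [:: n] b; rewrite /wt /= addn0 addn1.
Qed.

Lemma xN_red N b x : b != 0 -> homog N%:Z b x -> exists c, DD (x - c *: xN N b).
Proof.
move=> b0 hx; have hL : LD N.+1 N b x.
  move: x hx; apply: homog_ind => [|a M x wM _ IH]; first exact/LD_Sp/Sp_0.
  apply: LD_D IH; apply: LD_Z; apply: LD_Sp; rewrite -[M]mseqK.
  have wE : wt (mseq M) = N by rewrite -wtm_seq mseqK; lia.
  by apply: Sp_mon => //; move: wE; rewrite /wt; lia.
have [y hxy hy] := LD_red b0 hL.
suff [c yc] : exists c, y = c *: xN N b by exists c; rewrite -yc.
elim: hy => [|c s z hs sN _ [c' ->]]; first by exists 0; rewrite scale0r.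
exists (c + c'); rewrite scalerDl; congr (_ *: _ + _); rewrite /xN -sN.
case: s hs {sN} => [|j [|]] //= _.
by rewrite /wt /= addn0 addn1.
Qed.

(** * The action of omega and U on V[b] modulo D *)

Section Constants.
Variable b : int.
Hypothesis b0 : b != 0.
Let be : F := b%:~R.
Let be0 : be != 0. Proof. by rewrite intr_eq0. Qed.

Lemma L_mon1 n :
  L (mon [:: n] b) = be *: mon [:: n; 0%N] b + n.+1%:R *: mon [:: n.+1] b.
Proof. by rewrite L_cons (@L_vac) AZ A_mon. Qed.

Lemma L_mon2 n : L (mon [:: n; 0%N] b) =
  be *: mon [:: n; 0%N; 0%N] b + mon [:: n; 1%N] b + n.+1%:R *: mon [:: n.+1; 0%N] b.
Proof. by rewrite L_cons L_mon1 AD !AZ !A_mon scale1r. Qed.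

Lemma Om_vac : Om (mon [::] b) =
  mon [:: 0%N; 0%N] b + (2%:R * kap * be) *: mon [:: 1%N] b.
Proof.
by rewrite /Om (Q_vac 1 0) big_ord1 !hornerC scale1r.
Qed.

Lemma Om_mon n : Om (mon [:: n] b) = mon [:: n; 0%N; 0%N] b +
  (2%:R * kap * be) *: mon [:: n; 1%N] b +
  (2%:R * n.+1%:R * kap) *: mon [:: n.+2] b.
Proof.
rewrite -(@A_mon n [::]); have -> : Negz n = - n.+1%:Z by lia.
rewrite /Om Q_A -/Om Om_vac AD AZ.
have -> : - n.+1%:Z = Negz n by lia.
have -> : - (n.+1%:Z + 2) = Negz n.+2 by lia.
rewrite !A_mon; congr (_ + _ *: _); rewrite /Rp !hornerC.
by rewrite -[n.+1%:~R]/(n.+1%:R); ring.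
Qed.

Let Cn n : F := bin n 0 + bin n n.+3%:Z.

(** The mode of x_(n+1) x_1 of index -2, applied to e^b: [binp n] vanishes at 1, ..., n, which
    leaves two products, and [Cn] collects the zero-mode terms c = 0 and c = n+3. *)
Lemma rel2 n : DD (mon [:: n; 1%N] b + n.+1%:R *: mon [:: n.+1; 0%N] b +
  (Cn n * kap * be) *: mon [:: n.+2] b).
Proof.
have : DD (Q (binp n) n.+3%:Z (mon [::] b)) by apply: DD_Q1; rewrite size_binp; lia.
rewrite Q_vac big_ord_recr big_ord_recr /= big1 ?add0r => [|i _]; last first.
  by rewrite -[i.+1%:R]/((i.+1%:Z)%:~R) binpE bin_lt ?scale0r //; have := ltn_ord i; lia.
rewrite -[n.+1%:R in X in X -> _]/((n.+1%:Z)%:~R) -[n.+2%:R]/((n.+2%:Z)%:~R).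
rewrite -[n.+3%:R]/((n.+3%:Z)%:~R) -[X in (binp n).[X] + _](mulr0z 1).
rewrite !binpE bin_diag bin_diagS scale1r subSnn subnn.
done.
Qed.

Let be2 : be * be = (absz b * absz b)%:R.
Proof.
rewrite /be -intrM -[RHS]/((Posz _)%:~R); congr (_%:~R).
by rewrite -abszM; lia.
Qed.

Lemma Cn_nat n : exists t, Cn n = t%:R.
Proof.
have -> : Cn n = (-1) ^+ n + ('C(n.+2, n))%:R.
  by rewrite /Cn /bin /= addn0 binn mulr1 subn1.
have h : (0 < 'C(n.+2, n))%N by rewrite bin_gt0; lia.
rewrite -signr_odd; case: (odd n); rewrite ?expr0 ?expr1.
  by exists ('C(n.+2, n) - 1)%N; rewrite natrB // addrC.
by exists ('C(n.+2, n) + 1)%N; rewrite natrD addrC.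
Qed.

(* The eigenvalue in Om x_(n+1) = gam x_(n+3) modulo [DD]; it is nonzero because
   <alpha, alpha> < 0 makes all its terms add up with the same sign. *)
Definition gam n : F := kap * (Cn n + 2%:R * n.+1%:R * n.+3%:R -
  2%:R * Cn n * kap * (be * be)).

Lemma gam_neq0 n : gam n != 0.
Proof.
rewrite /gam mulf_neq0 //; first exact: kap0.
have [t ->] := Cn_nat n; rewrite be2 kapE mulrN mulNr opprK -!natrM -!natrD.
by rewrite pnatr_eq0; lia.
Qed.

Lemma Om_mon_red n : DD (Om (mon [:: n] b) - gam n *: mon [:: n.+2] b).
Proof.
(* The first summand removes the cubic monomial, [rel2] removes x_(n+1) x_2, and the last summand
   removes x_(n+2) x_1. *)
have -> : Om (mon [:: n] b) - gam n *: mon [:: n.+2] b =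
  be^-1 *: L (mon [:: n; 0%N] b) +
  (2%:R * kap * be - be^-1) *: (mon [:: n; 1%N] b + n.+1%:R *: mon [:: n.+1; 0%N] b +
    (Cn n * kap * be) *: mon [:: n.+2] b) +
  (- 2%:R * kap * n.+1%:R) *: L (mon [:: n.+1] b).
  rewrite Om_mon L_mon2 L_mon1 /gam; lmod.
  have := be0; move: (vcoord _ _) (vcoord _ _) (vcoord _ _) (vcoord _ _) => x y z t h.
  rewrite -[n.+3]addn1 -[n.+2]addn1 !natrD; field; exact: h.
apply: DD_D; last exact/DD_Z/DD_L1.
by apply: DD_D; apply: DD_Z; [exact: DD_L1 | exact: rel2].
Qed.

Lemma Om_vac_red : DD (Om (mon [::] b) - (2%:R * kap * be - be^-1) *: mon [:: 1%N] b).
Proof.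
have -> : Om (mon [::] b) - (2%:R * kap * be - be^-1) *: mon [:: 1%N] b =
   be^-1 *: L (mon [:: 0%N] b).
  by rewrite Om_vac L_mon1; lmod; have := be0 => h; field.
exact/DD_Z/DD_L1.
Qed.

Lemma Om_xN N : exists2 g, g != 0 & DD (Om (xN N b) - g *: xN N.+2 b).
Proof.
case: N => [|n]; last by exists (gam n); [exact: gam_neq0 | exact: Om_mon_red].
exists (2%:R * kap * be - be^-1); last exact: Om_vac_red.
have h := be0; have -> : 2%:R * kap * be - be^-1 = be^-1 * (2%:R * kap * (be * be) - 1).
  by field.
rewrite mulf_neq0 ?invr_neq0 // be2 kapE mulrN mulNr -opprD oppr_eq0.
by rewrite -!natrM natr1 pnatr_eq0.
Qed.

Lemma Om_iter_red j x : homog (2 * j)%N%:Z b x ->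
  exists c, DD (x - c *: iter j Om (mon [::] b)).
Proof.
elim: j x => [|j IH] x hx; first exact: (@xN_red 0 b x b0 hx).
have e2 : (2 * j.+1 = (2 * j).+2)%N by lia.
rewrite e2 in hx; have [c hc] := xN_red b0 hx.
have [g g0 hg] := Om_xN (2 * j); have [c' hc'] := IH _ (@homog_xN (2 * j)%N b).
exists (c / g * c').
have -> : x - (c / g * c') *: iter j.+1 Om (mon [::] b) =
  (x - c *: xN (2 * j).+2 b) - (c / g) *: (Om (xN (2 * j) b) - g *: xN (2 * j).+2 b) +
  (c / g) *: Om (xN (2 * j) b - c' *: iter j Om (mon [::] b)).
  by rewrite iterS OmB OmZ; lmod; field.
apply: DD_D; last exact/DD_Z/DD_Om.
by apply: DD_B => //; apply: DD_Z.
Qed.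

(** Odd weights start at x_1 e^b, a multiple of L(-1) e^b, and omega carries them upward with
    nonzero factors. *)
Lemma odd_red j x : homog (2 * j).+1%:Z b x -> DD x.
Proof.
elim: j x => [|j IH] x hx; have [c hc] := xN_red b0 hx.
  rewrite -(subrK (c *: xN 1 b) x); apply: DD_D => //; apply: DD_Z.
  have -> : xN (2 * 0).+1 b = be^-1 *: L (mon [::] b).
    by rewrite (@L_vac) scalerA mulVf // scale1r.
  exact/DD_Z/DD_L1.
have e2 : ((2 * j.+1).+1 = (2 * j).+3)%N by lia.
rewrite e2 in hc; have [g g0 hg] := Om_xN (2 * j).+1.
have -> : x = (x - c *: xN (2 * j).+3 b) -
  (c / g) *: (Om (xN (2 * j).+1 b) - g *: xN (2 * j).+3 b) +
  (c / g) *: Om (xN (2 * j).+1 b) by lmod; field.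
apply: DD_D; last exact/DD_Z/DD_Om/IH/homog_xN.
by apply: DD_B => //; apply: DD_Z.
Qed.

(** This is -2 <b alpha, b alpha>, written as a natural number so that signs and distinctness can be
    read off. *)
Definition Ybe : F := (4 * k * (absz b * absz b))%:R.

(* The coefficients are those for which [Tb] sends e^b into [DD]. *)
Definition Tb (v : V) : V :=
  (2%:R * kap * (Ybe + 1) * (Ybe + 9%:R)) *: U v - (2%:R * Ybe + 3%:R) *: Om (Om v).

(** With Y = [Ybe], modulo D the vector U e^b is -(2Y + 3)/b x_4 e^b and omega^2 e^b is -2 kap (Y +
    1)(Y + 9)/b x_4 e^b; [Tb] cross-multiplies. *)
Lemma Tb_vac : DD (Tb (mon [::] b)).
Proof.
have UE : U (mon [::] b) = mon [:: 2; 0]%N b + (4%:R * kap * be) *: mon [:: 3]%N b.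
  have pE x : (binp 2).[x] = 2%:R^-1 * ((x - 1) * (x - 2%:R)).
    by rewrite binp2E hornerM hornerC hornerM !hornerXsubC.
  rewrite /U (Q_vac _ 2) !big_ord_recl big_ord0 /= /bump /= !pE; lmod.
  by field.
have C1 : Cn 1 = 2%:R.
  by rewrite /Cn /bin /= !bin1 expr1 addn0 (_ : (4 - 1)%N = 3%N) //; ring.
have Yk : Ybe = - 2%:R * kap * (be * be).
  by rewrite /Ybe be2 kapE !natrM; ring.
have -> : Tb (mon [::] b) =
  (2%:R * kap * (Ybe + 1) * (Ybe + 9%:R) / be) *: L (mon [:: 2]%N b) -
  (2%:R * Ybe + 3%:R) *: (Om (Om (mon [::] b) -
       (2%:R * kap * be - be^-1) *: mon [:: 1%N] b) +
    (2%:R * kap * be - be^-1) *: (Om (mon [:: 1%N] b) - gam 1 *: mon [:: 3%N] b)).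
  rewrite /Tb UE OmB OmZ L_mon1 /gam C1 Yk; lmod.
  by have h := be0; field.
apply: DD_B; apply: DD_Z; first exact: DD_L1.
apply: DD_D; last exact/DD_Z/Om_mon_red.
exact/DD_Om/Om_vac_red.
Qed.

Lemma U_iter j v : DD (U (iter j Om v) - iter j Om (U v)).
Proof.
elim: j => [|j IH] /=; first by rewrite subrr; apply: DD_0.
rewrite -(subrK (Om (U (iter j Om v))) (U _)) -addrA; apply: DD_D; first exact: DD_UOm.
by rewrite -OmB; apply: DD_Om.
Qed.

Lemma DD_iter j x : DD x -> DD (iter j Om x).
Proof. by move=> hx; elim: j => //= j; apply: DD_Om. Qed.

Lemma iter_OmB j x y : iter j Om (x - y) = iter j Om x - iter j Om y.
Proof. by elim: j => //= j ->; rewrite OmB. Qed.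
Lemma iter_OmZ j c x : iter j Om (c *: x) = c *: iter j Om x.
Proof. by elim: j => //= j ->; rewrite OmZ. Qed.

Lemma TbD x y : Tb (x + y) = Tb x + Tb y.
Proof. by rewrite /Tb !(UD, OmD); lmod; ring. Qed.
Lemma TbZ c x : Tb (c *: x) = c *: Tb x.
Proof. by rewrite /Tb !(UZ, OmZ); lmod; ring. Qed.

Lemma DD_Tb x : DD x -> DD (Tb x).
Proof.
by move=> hx; apply: DD_B; apply: DD_Z; [exact: DD_U | exact/DD_Om/DD_Om].
Qed.

(** [Tb] commutes with omega modulo D, so its vanishing on e^b spreads to all omega^j e^b. *)
Lemma Tb_red N x : homog N%:Z b x -> DD (Tb x).
Proof.
move=> hx; have [j [eN|eN]] : exists j, N = (2 * j)%N \/ N = (2 * j).+1.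
- exists N./2; have := odd_double_half N; case: (odd N) => /= <-; lia.
- rewrite eN in hx; have [c hc] := Om_iter_red hx.
  rewrite -(subrK (c *: iter j Om (mon [::] b)) x) TbD TbZ.
  apply: DD_D; [exact: DD_Tb | apply: DD_Z].
  set v := mon [::] b; rewrite -(subrK (iter j Om (Tb v)) (Tb _)).
  apply: DD_D; last exact/DD_iter/Tb_vac.
  have -> : Tb (iter j Om v) - iter j Om (Tb v) =
      (2%:R * kap * (Ybe + 1) * (Ybe + 9%:R)) *: (U (iter j Om v) - iter j Om (U v)).
    rewrite /Tb iter_OmB !iter_OmZ (_ : iter j Om (Om (Om v)) = Om (Om (iter j Om v))).
      by lmod; ring.
    by rewrite -!iterS -!iterSr.
  exact/DD_Z/U_iter.
- by rewrite eN in hx; apply/DD_Tb/(odd_red hx).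
Qed.

End Constants.

(** Passing e^a_n, either factor of the quadratic operator contracts, which gives the two sums. For
    0 < c < W both are creation operators, and restoring normal order costs one more contraction;
    these terms make up K, which is independent of a and enters with a^2. *)
Lemma Q_e p (W : nat) : (0 < W)%N -> exists K, forall a n v, Q p W%:Z (e a n v) =
  e a n (Q p W%:Z v) +
  (kap * a%:~R) *: (NO (fun c => p.[c%:~R]) (e a) (W%:Z - n) v +
                    NO (fun c => p.[(W%:Z - c)%:~R]) (e a) (W%:Z - n) v) -
  ((kap * a%:~R) * (kap * a%:~R) * K) *: e a (n - W%:Z) v.
Proof.
move=> W0; pose chi (c : int) : F := if 0 < c < W%:Z then p.[c%:~R] else 0.
exists (\sum_(i < W) chi i%:Z) => a n v; set lam := kap * a%:~R.
pose P c : F := p.[c%:~R].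
have fe := field_e a.
have zA : zfin (fun c => P c *: nterm A W%:Z v c) by exact/zfinZ/zfin_nterm/field_A.
have z1 : zfin (fun c => lam *: (P c *: nterm (e a) (W%:Z - n) v c)).
  exact/(zfin_lin ( *:%R lam))/zfinZ/zfin_nterm.
have zr : zfin (fun c => P (W%:Z - c) *: nterm (e a) (W%:Z - n) v c).
  exact/zfinZ/zfin_nterm.
have zr' : zfin (fun c => P c *: nterm (e a) (W%:Z - n) v (W%:Z - c)).
  have [N hN] := zfin_nterm fe (W%:Z - n) v.
  by exists (N + W)%N => c hc; rewrite hN ?scaler0 //; lia.
have zs2 : zs (fun c => P c *: nterm (e a) (W%:Z - n) v (W%:Z - c)) =
    NO (fun c => p.[(W%:Z - c)%:~R]) (e a) (W%:Z - n) v.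
  rewrite /NO -(zs_shift W%:Z zr') -(zs_opp (zfin_shift W%:Z zr')).
  by apply: eq_zs => c; rewrite /P; congr (_.[_%:~R] *: nterm _ _ _ _); lia.
have zchi (u : V) : zfin (fun c => chi c *: u) /\
    zs (fun c => chi c *: u) = (\sum_(i < W) chi i%:Z) *: u.
  have out c : (c < 0) || (W%:Z <= c) -> chi c = 0.
    by rewrite /chi; case: ifP => //; lia.
  split; first by exists W.+1 => c hc; rewrite out ?scale0r //; lia.
  rewrite (@zs_nat _ _ W) ?scaler_suml // => c hc; rewrite out ?scale0r //; lia.
have [zc sc] := zchi (e a (n - W%:Z) v).
have term c : P c *: nterm A W%:Z (e a n v) c =
  e a n (P c *: nterm A W%:Z v c) + (lam *: (P c *: nterm (e a) (W%:Z - n) v c) +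
  (lam *: (P c *: nterm (e a) (W%:Z - n) v (W%:Z - c)) +
   (- (lam * lam)) *: (chi c *: e a (n - W%:Z) v))).
  have i1 : c - (W%:Z - n) = n + (c - W%:Z) by lia.
  have i2 : W%:Z - c - (W%:Z - n) = n + - c by lia.
  have i3 : - (W%:Z - c) = c - W%:Z by lia.
  have i4 : n - W%:Z = n + - c + (c - W%:Z) by lia.
  have Ae p' n' u : A p' (e a n' u) = e a n' (A p' u) + lam *: e a (n' + p') u.
    exact: A_e.
  have [c0|c0] := ltrP 0 c.
    rewrite !(nterm_pos _ _ _ c0) i1 Ae AD AZ Ae; have [cW|cW] := ltrP c W%:Z.
      rewrite nterm_pos; last by lia.
      rewrite i2 i3 [A (c - W%:Z) (e a _ v)]Ae -i4 /chi c0 cW -/(P c) linearZ /=; lmod; ring.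
    rewrite nterm_npos; last by lia.
    rewrite i2 i3 /chi c0 ltNge cW /= linearZ /=; lmod; ring.
  rewrite !(nterm_npos _ _ _ c0) i1 Ae AD AZ nterm_pos; last by lia.
  rewrite i2 i3 [A _ (e a n _)]Ae /chi ltNge c0 /= linearZ /=; lmod; ring.
rewrite {1}/Q /NO (eq_zs term).
have z4 : zfin (fun c => - (lam * lam) *: (chi c *: e a (n - W%:Z) v)).
  exact: (zfin_lin ( *:%R _)).
have z3 : zfin (fun c => lam *: (P c *: nterm (e a) (W%:Z - n) v (W%:Z - c))).
  exact: (zfin_lin ( *:%R lam)).
rewrite (zsD (zfin_lin (e a n) zA) (zfinD z1 (zfinD z3 z4))).
rewrite (zsD z1 (zfinD z3 z4)) (zsD z3 z4) (zs_lin (e a n) zA).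
rewrite (zs_lin ( *:%R lam) zr') zs2 (zs_lin ( *:%R _) zc) sc.
rewrite (zs_lin ( *:%R lam)); last exact/zfinZ/zfin_nterm.
rewrite -[zs (fun c => P c *: nterm A _ _ _)]/(Q p W%:Z v) /=.
rewrite -[zs (fun c => P c *: nterm (e a) _ _ _)]/(NO P (e a) (W%:Z - n) v) /P.
by lmod; ring.
Qed.

(** For p = 1 both contracted sums are translates of e^a by [e_translation], which absorbs the odd
    factor a; the coefficient that remains is even in a. *)
Lemma Om_e : exists C : int -> int -> F, (forall a n, C (- a) n = C a n) /\
  forall a n v, Om (e a n v) = e a n (Om v) + C a n *: e a (n - 2) v.
Proof.
have [K hK] := @Q_e 1 2 isT.
exists (fun a n => - 2%:R * kap * (n - 1)%:~R - kap * a%:~R * (kap * a%:~R) * K).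
split=> [a n|a n v]; first by rewrite mulrNz; ring.
have tr : a%:~R *: NO (fun _ => 1) (e a) (2 - n) v =
    - (n - 1)%:~R *: e a (n - 2) v.
  have -> : 2 - n = 1 - (n - 1) by lia.
  by rewrite (@e_translation) (_ : n - 1 - 1 = n - 2) //; lia.
have E1 : NO (fun c => (1 : {poly F}).[c%:~R]) (e a) (2%:Z - n) v =
    NO (fun _ => 1) (e a) (2 - n) v.
  by apply: eq_NO => // c; rewrite hornerC.
have E2 : NO (fun c => (1 : {poly F}).[(2%:Z - c)%:~R]) (e a) (2%:Z - n) v =
    NO (fun _ => 1) (e a) (2 - n) v.
  by apply: eq_NO => // c; rewrite hornerC.
rewrite /Om hK E1 E2 -mulr2n -scalerA -scalerMnr tr.
by rewrite -scaler_nat; lmod; ring.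
Qed.

(** The two contracted sums for U, combined by C(3-c, 2) = C(c-1, 2) - C(c-1, 1) + 1 into modes of
    x_3 e^a, x_2 e^a and x_1 e^a. *)
Definition Xop (a n : int) (v : V) : V :=
  2%:R *: Mo [:: 2%N] a (n - 1) v - Mo [:: 1%N] a (n - 2) v + Mo [:: 0%N] a (n - 3) v.

Lemma U_e : exists K : F, forall a n v, U (e a n v) =
  e a n (U v) + (kap * a%:~R) *: Xop a n v -
  (kap * a%:~R * (kap * a%:~R) * K) *: e a (n - 4) v.
Proof.
have [K hK] := @Q_e (binp 2) 4 isT; exists K => a n v.
have fe := field_e a.
rewrite /U hK; congr (_ + _ *: _ - _).
have -> : NO (fun c => (binp 2).[c%:~R]) (e a) (4%:Z - n) v = Mo [:: 2%N] a (n - 1) v.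
  rewrite /= (_ : 3%:Z - (n - 1) = 4%:Z - n); last by lia.
  by apply: eq_NO => // c; exact: (@binpE 2 c).
have pE x : (binp 2).[x] = 2%:R^-1 * ((x - 1) * (x - 2%:R)).
  by rewrite binp2E hornerM hornerC hornerM !hornerXsubC.
have p1E x : (binp 1).[x] = x - 1.
  by rewrite /= invr1 scale1r mul1r hornerXsubC.
have -> : NO (fun c => (binp 2).[(4%:Z - c)%:~R]) (e a) (4%:Z - n) v =
   NO (fun c => 1 * bin 2 c + (- 1 * bin 1 c + 1 * bin 0 c)) (e a) (4%:Z - n) v.
  apply: eq_NO => // c; rewrite -!binpE pE pE p1E hornerC rmorphB /=.
  by field.
rewrite !(NO_addP fe) !(NO_scaleP fe) /Xop /=.
have -> : 3%:Z - (n - 1) = 4%:Z - n by lia.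
have -> : 2%:Z - (n - 2) = 4%:Z - n by lia.
have -> : 1%:Z - (n - 3) = 4%:Z - n by lia.
by lmod; ring.
Qed.

(** * Pairs e^m + e^(-m) and transfer between charges *)

Section Pairs.
Variable m : int.

(* The images of the modes of E^m = e^m + e^(-m) of index at most -2. *)
Inductive E3 : V -> Prop :=
| E3_0 : E3 0
| E3_S c n v x : n <= -2 -> E3 x -> E3 (c *: (e m n v + e (- m) n v) + x).

Lemma E3_D x y : E3 x -> E3 y -> E3 (x + y).
Proof.
move=> hx hy; elim: hx => [|c n v z hn _ IH]; first by rewrite add0r.
by rewrite -addrA; apply: E3_S.
Qed.

Lemma E3_Z a x : E3 x -> E3 (a *: x).
Proof.
elim => [|c n v z hn _ IH]; first by rewrite scaler0; apply: E3_0.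
by rewrite scalerDr scalerA; apply: E3_S.
Qed.

Lemma E3_gen n v : n <= -2 -> E3 (e m n v + e (- m) n v).
Proof.
by move=> hn; rewrite -[_ + _]scale1r -[_ *: _]addr0; apply: E3_S => //; apply: E3_0.
Qed.

Lemma Ct_pair n v : n <= -2 -> Ct (e m n v + e (- m) n v).
Proof.
move=> hn; have -> : e m n v + e (- m) n v =
    Y n (mon [::] m + mon [::] (- m)) v by rewrite YDl !Y_mon.
by apply: Ct_Y => //; rewrite raddfD /= !theta_mon !scale1r opprK addrC.
Qed.

Lemma Ct_pair1 j n v : n <= -2 -> Ct (Mo [:: j] m n v - Mo [:: j] (- m) n v).
Proof.
move=> hn; have -> : Mo [:: j] m n v - Mo [:: j] (- m) n v =
    Y n (mon [:: j] m + (-1) *: mon [:: j] (- m)) v.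
  by rewrite YDl YZl !Y_mon scaleN1r.
apply: Ct_Y => //; rewrite linearD linearZ /= !theta_mon opprK expr1 !scaleN1r.
by rewrite opprK addrC.
Qed.

Lemma Ct_E3 x : E3 x -> Ct x.
Proof.
elim => [|c n v z hn _ IH]; first exact: Ct_0.
by apply: Ct_lin => //; apply: Ct_pair.
Qed.

Lemma E3_Om x : E3 x -> E3 (Om x).
Proof.
have [C [Ce hC]] := Om_e.
elim => [|c n v z hn _ IH]; first by rewrite raddf0; apply: E3_0.
rewrite OmD OmZ OmD !hC Ce addrACA -scalerDr; apply: E3_D => //.
apply: E3_Z; apply: E3_D; first exact: E3_gen.
by apply/E3_Z/E3_gen; lia.
Qed.

(** The factor of [Xop] is odd in m, so its terms form differences, which are modes of the
    theta-fixed vectors of [Ct_pair1]. They leave [E3] but remain good. *)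
Lemma Ct_U_E3 x : E3 x -> Ct (U x).
Proof.
have [K hK] := U_e.
elim => [|c n v z hn _ IH]; first by rewrite raddf0; apply: Ct_0.
rewrite UD UZ UD !hK; apply: Ct_lin => //.
have -> : e m n (U v) + (kap * m%:~R) *: Xop m n v -
     (kap * m%:~R * (kap * m%:~R) * K) *: e m (n - 4) v +
   (e (- m) n (U v) + (kap * (- m)%:~R) *: Xop (- m) n v -
     (kap * (- m)%:~R * (kap * (- m)%:~R) * K) *: e (- m) (n - 4) v) =
   (e m n (U v) + e (- m) n (U v)) +
   ((kap * m%:~R) *: (2%:R *: (Mo [:: 2%N] m (n - 1) v - Mo [:: 2%N] (- m) (n - 1) v) +
     ((-1) *: (Mo [:: 1%N] m (n - 2) v - Mo [:: 1%N] (- m) (n - 2) v) +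
      (Mo [:: 0%N] m (n - 3) v - Mo [:: 0%N] (- m) (n - 3) v))) +
    (- (kap * m%:~R * (kap * m%:~R) * K)) *: (e m (n - 4) v + e (- m) (n - 4) v)).
  by rewrite mulrNz /Xop; lmod; ring.
apply: Ct_D; first exact: Ct_pair.
apply: Ct_D; last by apply/Ct_Z/Ct_pair; lia.
apply: Ct_Z; apply: Ct_lin; first by apply: Ct_pair1; lia.
by apply: Ct_lin; apply: Ct_pair1; lia.
Qed.

Lemma Ct_Tb_E3 b x : E3 x -> Ct (Tb b x).
Proof.
move=> hx; rewrite /Tb -scaleNr; apply: Ct_lin; first exact: Ct_U_E3.
by apply/Ct_Z/Ct_E3/E3_Om/E3_Om.
Qed.

Variable b : int.

Inductive Yp : V -> Prop :=
| Yp_0 : Yp 0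
| Yp_S c n t x : n <= -2 -> Yp x -> Yp (c *: e (- m) n (mon t (m + b)) + x).

Lemma Yp_D x y : Yp x -> Yp y -> Yp (x + y).
Proof.
move=> hx hy; elim: hx => [|c n v z hn _ IH]; first by rewrite add0r.
by rewrite -addrA; apply: Yp_S.
Qed.

Lemma Yp_Z a x : Yp x -> Yp (a *: x).
Proof.
elim => [|c n v z hn _ IH]; first by rewrite scaler0; apply: Yp_0.
by rewrite scalerDr scalerA; apply: Yp_S.
Qed.

Lemma Yp_A j x : Yp x -> Yp (A (Negz j) x).
Proof.
elim => [|c n v z hn _ IH]; first by rewrite raddf0; apply: Yp_0.
rewrite AD AZ A_e A_mon; apply: Yp_D => //; apply: Yp_Z.
have one u n' : n' <= -2 -> Yp (e (- m) n' (mon u (m + b))).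
  by move=> h; rewrite -[e _ _ _]scale1r -[_ *: _]addr0; apply: Yp_S => //; apply: Yp_0.
by apply: Yp_D; [apply: one | apply/Yp_Z/one; lia].
Qed.

(* The lowest mode e^(-m)_n e^(m+b) is e^b, and commuting with A moves the
   index n down only, so the modes of index at most -2 already give all of V[b]. *)
Lemma Yp_mon s : 0 < m * (m + b) -> Yp (mon s b).
Proof.
move=> hm; elim: s => [|j s IH]; last by rewrite -(@A_mon); apply: Yp_A.
(* This n gives [S] the index 0; it equals -2k m (m + b) - 1, which is at most -3. *)
pose n := - form k (- m) (m + b) - 1.
have hn : n <= -2.
  by rewrite /n /Defs.form; move: (m * (m + b)) hm (mulrA (2%:Z * k%:Z) m (m + b)); nia.
have <- : e (- m) n (mon [::] (m + b)) = mon [::] b.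
  rewrite (e_homog _ _ (@homog_mon [::] (m + b))) (zs1 (d := 0)) => [|q q0].
    rewrite /eterm /T E0 sh_mon addrA addNr add0r.
    by rewrite add0r (_ : - form k (- m) (m + b) - n - 1 = 0) /S ?E0 // /n; lia.
  rewrite /eterm; suff -> : T (- m) q (sh (- m) (mon [::] (m + b))) = 0.
    exact: raddf0.
  have [qn|qn] := ltrP q 0; first by rewrite /T E_neg.
  apply: (@T_trunc (- m) q _ _ _ (homog_sh (- m) (@homog_mon [::] (m + b)))).
  by rewrite /wt /=; lia.
by rewrite -[e _ _ _]scale1r -[_ *: _]addr0; apply: Yp_S => //; apply: Yp_0.
Qed.

Lemma Yp_Ct (P : V -> V) (PD : forall c x y, P (c *: x + y) = c *: P x + P y) :
  (forall n t, n <= -2 -> Ct (P (e (- m) n (mon t (m + b))))) ->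
  forall y, Yp y -> Ct (P y).
Proof.
move=> hP y; elim => [|c n t x hn _ IH]; last by rewrite PD; apply/Ct_lin/IH/hP.
have -> : P 0 = 0 by rewrite -[X in P X](addNr 0) -scaleN1r PD scaleN1r addNr.
exact: Ct_0.
Qed.

End Pairs.

Lemma homog_e_mon m b n t :
  homog ((wt t)%:Z - form k m (m + b) - n - 1) (2%:Z * m + b) (e m n (mon t (m + b))).
Proof.
have -> : 2%:Z * m + b = m + (m + b) by lia.
by apply: homog_e; apply: homog_mon.
Qed.

Lemma Ct_Tb_mon m b s : 0 < m -> 0 < m + b -> Ct (Tb (2%:Z * m + b) (mon s b)).
Proof.
move=> m0 mb0; have Tlin c x y : Tb (2%:Z * m + b) (c *: x + y) =
    c *: Tb (2%:Z * m + b) x + Tb (2%:Z * m + b) y by rewrite TbD TbZ.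
apply: (@Yp_Ct m b _ Tlin); last by apply: Yp_mon; rewrite mulr_gt0.
move=> n t hn; set v := mon t (m + b).
(* The mode is the pair minus e^m_n v, and the latter lies in V[2m + b]. *)
rewrite -[e (- m) n v](addKr (e m n v)) [- _ + _]addrC TbD -scaleN1r TbZ.
apply: Ct_D; first by apply: (@Ct_Tb_E3 m); apply: E3_gen.
apply: Ct_Z; have := @homog_e_mon m b n t.
case: (_ - _ - _ - _) => [N|N] hN.
  by apply: Ct_DD; apply: (Tb_red _ hN); lia.
rewrite -/v (homog_neg _ hN) // -(scale0r 0) TbZ scale0r; exact: Ct_0.
Qed.

(* T_(M) and T_(M + 2) are independent combinations of U and Om^2, because
   Ybe takes distinct nonnegative values at M and M + 2. *)
Lemma Ct_Om2 y : Ct (Om (Om y)).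
Proof.
elim/mon_ind: y => [|c s b x IH]; first by rewrite !raddf0; apply: Ct_0.
rewrite !(OmD, OmZ); apply: Ct_lin IH => {x}.
pose m : int := (absz b).+1%:Z; pose M : int := 2%:Z * m + b.
have M0 : 0 < M by rewrite /M /m; lia.
have h1 : Ct (Tb M (mon s b)) by apply: Ct_Tb_mon; rewrite /m; lia.
have h2 : Ct (Tb (M + 2%:Z) (mon s b)).
  have -> : M + 2%:Z = 2%:Z * (m + 1) + b by rewrite /M; lia.
  by apply: Ct_Tb_mon; rewrite /m; lia.
pose y1 := (4 * k * (absz M * absz M))%N.
pose y2 := (4 * k * (absz (M + 2%:Z)%R * absz (M + 2%:Z)%R))%N.
have y12 : (y1 < y2)%N by rewrite /y1 /y2 ltn_pmul2l; [apply: ltn_mul; lia | lia].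
have k0 := kap0.
(* The determinant of the two combinations; the second factor of the product is positive, and the
   first is so because y1 < y2. *)
pose d : F := 2%:R * kap * ((y2 - y1) * (2 * y1 * y2 + 3 * (y1 + y2) + 12))%N%:R.
have d0 : d != 0.
  by rewrite !mulf_neq0 ?pnatr_eq0 // muln_eq0 negb_or subn_eq0 -ltnNge y12 addn_eq0 andbF.
have -> : Om (Om (mon s b)) = d^-1 *:
   ((2%:R * kap * (y1%:R + 1) * (y1%:R + 9%:R)) *: Tb (M + 2%:Z) (mon s b) +
   (- (2%:R * kap * (y2%:R + 1) * (y2%:R + 9%:R))) *: Tb M (mon s b)).
  apply: (scalerI d0); rewrite scalerA divff // scale1r /Tb.
  rewrite -[Ybe M]/(y1%:R) -[Ybe (M + 2%:Z)]/(y2%:R) /d natrM natrB 1?ltnW //.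
  by rewrite !(natrM, natrD); lmod; ring.
by apply/Ct_Z/Ct_lin/Ct_Z.
Qed.

Lemma Ct_homog b N x : b != 0 -> (4 <= N)%N -> homog N%:Z b x -> Ct x.
Proof.
move=> b0 N4 hx; have [j [eN|eN]] : exists j, N = (2 * j)%N \/ N = (2 * j).+1.
- exists N./2; have := odd_double_half N; case: (odd N) => /= <-; lia.
- rewrite eN in hx; have [c hc] := Om_iter_red b0 hx.
  rewrite -(subrK (c *: iter j Om (mon [::] b)) x); apply: Ct_D; first exact: Ct_DD hc.
  apply: Ct_Z; have -> : j = (j - 2).+2 by lia.
  exact: Ct_Om2.
- by rewrite eN in hx; apply: Ct_DD; apply: (odd_red b0 hx).
Qed.

Lemma Ct_all v : Ct v.
Proof.
elim/mon_ind: v => [|c s b x IH]; first exact: Ct_0.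
(* This m makes m and m + b at least 2, so e^m_n v has weight at least 4 and charge 2m + b > 0, also
   when b = 0. *)
apply: Ct_lin IH => {x}; pose m : int := (absz b).+2%:Z.
apply: (@Yp_Ct m b id) => //; last by apply: Yp_mon; rewrite mulr_gt0 /m; lia.
move=> n t hn; rewrite -[e (- m) n _](addKr (e m n (mon t (m + b)))).
rewrite [- _ + _]addrC; apply: Ct_D; first exact: Ct_pair.
rewrite -scaleN1r; apply: Ct_Z; have := @homog_e_mon m b n t.
have : 4 <= (wt t)%:Z - form k m (m + b) - n - 1.
  have : 4 <= 2%:Z * k%:Z * (m * (m + b)) by rewrite /m; nia.
  by rewrite /Defs.form mulrA; lia.
case: (_ - _ - _ - _) => [N|N] // N4 hN.
by apply: (Ct_homog _ _ hN) => //; rewrite /m; lia.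
Qed.

Lemma in_Vplus_C2 (w : vec F) : in_Vplus w <-> in_C2_Vplus k w.
Proof.
split=> [/in_VplusP hw|/in_C2P hw]; last by apply/in_VplusP; apply: C2_theta hw.
by apply/in_C2P; apply: (C2_of_Ct Ct_all).
Qed.

End LatticeVertexAlgebra.

(* V_L^+ = C_2(V_L^+) for L = Z alpha, <alpha,alpha> = -2k, k > 0. *)
Theorem theorem4p5 (F : numClosedFieldType) (k : nat) (hk : (0 < k)%N)
  (w : vec F) :
  in_Vplus w <-> in_C2_Vplus k w.
Proof. exact: in_Vplus_C2. Qed.
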